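(* Let $\alpha\in(7/8,1)$ be fixed. Suppose $p=p(n)\in(0,1)$ satisfies $np\to\infty$ and $1-p=\Omega(1)$. Then for every positive integer $\ell=\ell(n)$ with $\ell=\Omega(n\sqrt p)$, $\ell\le n/2-n^\alpha$ and $\ell^3=o(n^4p^2)$, $$\frac{\ln\!\big(e^{\beta_{n,\ell}^2/2}X_{n,\ell}/\lambda_{n,\ell}\big)}{\beta_{n,\ell}}\xrightarrow{d}\mathcal{N}(0,1)\quad\text{as } n\to\infty,$$ where $\beta_{n,\ell}=\ell\sqrt{(1-p)/(pN)}$ and $N=\binom n2$.
   Context: $\mathcal{G}(n,p)$ is the binomial random graph on vertex set $[n]$ in which each edge is present independently with probability $p$. An $\ell$-matching is a matching with exactly $\ell$ edges; $X_{n,\ell}$ is the number of $\ell$-matchings contained in $\mathcal{G}(n,p)$ and $\lambda_{n,\ell}=\mathbf{E}X_{n,\ell}=\binom{n}{2\ell}\frac{(2\ell)!}{2^\ell\ell!}p^\ell$. $\mathcal{N}(0,1)$ is the standard normal distribution. All asymptotics are as $n\to\infty$; $1-p=\Omega(1)$ means $1-p$ is bounded away from $0$. *)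

(* Defs.v *)
From HB Require Import structures.
From mathcomp Require Import all_boot all_order all_algebra.
From mathcomp Require Import all_classical all_reals all_analysis.
From mathcomp Require Import measurable_realfun.

Set Implicit Arguments.
Unset Strict Implicit.
Unset Printing Implicit Defensive.

Import Order.TTheory GRing.Theory Num.Theory.
Import numFieldNormedType.Exports.

Local Open Scope classical_set_scope.
Local Open Scope ring_scope.

Definition edge (n : nat) := {e : {set 'I_n} | #|e| == 2%N}.

(* A simple graph on the labelled vertex set 'I_n is its set of edges. *)
Definition graph (n : nat) := {set edge n}.

HB.instance Definition _ n := Finite.on (graph n).
HB.instance Definition _ n := isPointed.Build (graph n) finset.set0.
HB.instance Definition _ n := @isMeasurable.Build default_measure_display
  (graph n) discrete_measurable discrete_measurable0
  discrete_measurableC discrete_measurableU.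

Definition is_matching n (M : graph n) : bool :=
  [forall e in M, forall f in M, (e != f) ==> [disjoint val e & val f]].

Definition num_matchings n (l : nat) (G : graph n) : nat :=
  #|[pred M : graph n | [&& is_matching M, #|M| == l & M \subset G]]|.

Definition gnp_pmf (R : numDomainType) n (p : R) (G : graph n) : R :=
  \prod_(e : edge n) bernoulli_pmf p (e \in G).

(* As for [bernoulli_prob], the case where 0 <= p <= 1 fails is a dummy value
   that makes [gnp_prob n p] a probability measure for every p. *)
Definition gnp_prob (R : realFieldType) n (p : R) : set (graph n) -> \bar R :=
  fun A => if 0 <= p <= 1 then (\sum_(G \in A) (gnp_pmf p G)%:E)%E
           else \d_(point : graph n) A.
Arguments gnp_prob {R} n p A.

Section gnp_prob.
Variables (R : realType) (n : nat) (p : R).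

Lemma gnp_pmf_ge0 (G : graph n) : 0 <= p <= 1 -> 0 <= gnp_pmf p G.
Proof. by move=> p01; apply: prodr_ge0 => e _; exact: bernoulli_pmf_ge0. Qed.

Lemma gnp_pmf_sum1 : \sum_(G : graph n) gnp_pmf p G = 1.
Proof.
have := @bigA_distr_bigA R 0 1 *%R +%R (edge n) bool
  (fun=> bernoulli_pmf p).
under eq_bigr do rewrite big_bool/= /bernoulli_pmf subrKC.
rewrite big1// => ->.
pose h (f : {ffun edge n -> bool}) : graph n := finset (fun e => f e).
pose k (G : graph n) : {ffun edge n -> bool} := [ffun e => e \in G].
rewrite (reindex h)/=; last first.
  exists k => [f _|G _]; first by apply/ffunP => e; rewrite ffunE inE.
  by apply/finset.setP => e; rewrite inE ffunE.
by apply: eq_bigr => f _; apply: eq_bigr => e _; rewrite inE.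
Qed.

Local Notation P := (gnp_prob n p).

Let gnp_prob0 : P set0 = 0%E.
Proof. by rewrite /gnp_prob; case: ifPn => // p01; rewrite fsbig_set0. Qed.

Let gnp_prob_ge0 A : (0 <= P A)%E.
Proof.
rewrite /gnp_prob; case: ifPn => // p01.
rewrite fsbig_finite//= sumEFin lee_fin.
by apply: sumr_ge0 => /= G _; exact: gnp_pmf_ge0.
Qed.

Let gnp_prob_sigma_additive : semi_sigma_additive P.
Proof.
move=> F mF tF mUF; rewrite /gnp_prob; case: ifPn => p01; last first.
  exact: measure_semi_sigma_additive.
apply: cvg_toP.
  apply: ereal_nondecreasing_is_cvgn => m k mk.
  apply: lee_sum_nneg_natr => // i _ _.
  rewrite fsbig_finite//= sumEFin lee_fin.
  by apply: sumr_ge0 => /= G _; exact: gnp_pmf_ge0.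
transitivity (\sum_(0 <= i <oo) (\esum_(G in F i) (gnp_pmf p G)%:E))%E.
  apply: eq_eseriesr => k _; rewrite esum_fset//= => G _.
  by rewrite lee_fin gnp_pmf_ge0.
rewrite -nneseries_sum_bigcup//=; last first.
  by move=> G; rewrite lee_fin gnp_pmf_ge0.
by rewrite esum_fset//= => G _; rewrite lee_fin gnp_pmf_ge0.
Qed.

HB.instance Definition _ := isMeasure.Build _ _ _ P
  gnp_prob0 gnp_prob_ge0 gnp_prob_sigma_additive.

Let gnp_prob_setT : P [set: _] = 1%E.
Proof.
rewrite /gnp_prob; case: ifPn => _; last by rewrite /= diracT.
rewrite fsbig_finite//= sumEFin -gnp_pmf_sum1; congr EFin.
apply: perm_big; apply: uniq_perm => [||G].
- exact: finmap.fset_uniq.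
- exact: index_enum_uniq.
- rewrite in_fset_set; last exact: finite_finset.
  by rewrite mem_set//; exact/esym/mem_index_enum.
Qed.

HB.instance Definition _ :=
  @Measure_isProbability.Build _ _ R P gnp_prob_setT.

End gnp_prob.

Definition gnp_mean (R : realType) n (p : R) (l : nat) : R :=
  fine ('E_(gnp_prob n p)[fun G => (num_matchings l G)%:R])%E.

Definition beta_nl (R : realType) n (p : R) (l : nat) : R :=
  l%:R * Num.sqrt ((1 - p) / (p * ('C(n, 2))%:R)).

(* [lne] takes the value -oo at 0, so this random variable equals -oo on the
   event that G contains no l-matching. *)
Definition log_matchings (R : realType) n (p : R) (l : nat)
    (G : graph n) : \bar R :=
  (lne (expR (beta_nl n p l ^+ 2 / 2) * (num_matchings l G)%:R
        / gnp_mean n p l)%:E * (beta_nl n p l)^-1%:E)%E.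

Section log_matchings_mfun.
Variables (R : realType) (n : nat) (p : R) (l : nat).

Let measurable_log_matchings :
  measurable_fun [set: graph n] (@log_matchings R n p l).
Proof. by []. Qed.

HB.instance Definition _ := isMeasurableFun.Build _ _ (graph n) (\bar R)
  (@log_matchings R n p l) measurable_log_matchings.

End log_matchings_mfun.

(* Convergence in distribution of extended-real random variables to a law mu
   on the reals: the distribution functions converge at every continuity point
   of that of mu. Since mu has total mass 1 on the reals, the mass
   of Y n at -oo and at +oo is forced to vanish in the limit. *)
Definition cvg_in_distribution (R : realType) (d : nat -> measure_display)
    (T : forall n, measurableType (d n)) (P : forall n, probability (T n) R)
    (Y : forall n, {RV (P n) >-> \bar R})
    (mu : probability (measurableTypeR R) R) : Prop :=
  forall t : R, {for t, continuous (fun x : R => mu `]-oo, x]%classic)} ->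
    distribution (P n) (Y n) [set y | y <= t%:E]%E @[n --> \oo]
      --> mu `]-oo, t]%classic.

(* Main.v *)
(** Write N = 'C(n, 2) and condition on the number m of edges.  A uniform graph
with m edges contains a fixed set of s edges with probability m^_s / N^_s.  If
K is the number of common edges of two independent uniform l-matchings, then
E (K choose j) <= (l^2 / N)^j / j! holds exactly as soon as 2 l < n, so the
exponential moments of K are at most those of a Poisson variable; hence
E[X^2 | m] <= exp (2 l^3 / (m (m - 2 l))) E[X | m]^2 and X / E[X | m] tends to
1 in probability because l^3 = o(m^2).  Finally E[X | m] / E X is the product
of the (m - i) / (p (N - i)), i < l, and taking logarithms gives
ln (exp (beta^2 / 2) E[X | m] / E X) = beta x + o(beta), where x is the
standardized number of edges, so the theorem reduces to the central limit
theorem for binomial distributions.  The latter is proved without Stirling's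
formula: consecutive ratios of binomial weights are compared with those of the
increments of the normal distribution function, and the unknown normalising
constant is eliminated by Chebyshev's inequality. *)

Require Import Defs.
From HB Require Import structures.
From mathcomp Require Import all_boot all_order all_algebra.
From mathcomp Require Import all_classical all_reals all_analysis.
From mathcomp Require Import measurable_realfun.
From mathcomp Require Import ring lra zify.
Import Order.TTheory GRing.Theory Num.Theory.
Import numFieldNormedType.Exports.
Set Implicit Arguments.
Unset Strict Implicit.
Unset Printing Implicit Defensive.
Local Open Scope ring_scope.

(** * Random subsets of fixed size *)

Section supersets.
(* [all_classical] shadows many names of [fintype] and [finset]. *)
Import boot.fintype boot.finset.
Variables (T : finType) (R : realType).
Implicit Types (S G M : {set T}) (F : {set {set T}}).

(** Conditioning is forced. Without it E X^2 / (E X)^2 is about exp (beta^2), and [beta] is bounded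
    below since l = Omega(n sqrt p), so a plain second moment argument cannot give concentration:
    the fluctuations of the edge count alone move ln X by about [beta] times a standard normal
    variable. Given m edges, common edges contribute a factor of about exp (l^2 (N - m) / (m N)),
    while m^_(2l) / N^_(2l) falls short of the square of m^_l / N^_l by about the inverse factor;
    what survives has an exponent of order l^3 / m^2. The correction exp (beta^2 / 2) comes from the
    drift in i of the factors of E[X | m] / E X, which adds -(1 - p) l (l - 1) / (2 p N) to the
    logarithm. The matching and edge-count estimates are inequalities at a fixed n with explicit
    parameters. A single [kappa] bounds l / (p N), the relative standard deviation of the edge count
    and l^3 / (p N)^2; the lower bound on [beta] turns errors O(kappa) into errors small relative to
    [beta]. *)

Lemma card_supersets S m :
  (#|[set G : {set T} | (S \subset G) && (#|G| == m)]| * #|T| ^_ #|S|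
   = 'C(#|T|, m) * m ^_ #|S|)%N.
Proof.
have [sm|ms] := leqP #|S| m; last first.
  rewrite (ffact_small ms) muln0; apply/eqP; rewrite muln_eq0; apply/orP; left.
  rewrite cards_eq0; apply/eqP/setP => G; rewrite !inE.
  apply/negP => /andP[/subset_leq_card SG /eqP Gm].
  by rewrite Gm leqNgt ms in SG.
(* A superset [G] of [S] is recovered from [G :\: S], so the supersets correspond to the subsets of
   the complement of size m - s. *)
pose A := [set B : {set T} | B \subset ~: S & #|B| == (m - #|S|)%N].
have -> : #|[set G : {set T} | (S \subset G) && (#|G| == m)]| = #|A|.
  rewrite -(@card_in_imset _ _ (fun B => B :|: S) (mem A)).
    apply: eq_card => G; rewrite !inE; apply/andP/imsetP => [[SG /eqP Gm]|].
      exists (G :\: S); last first.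
        apply/setP=> x; rewrite !inE; have := subsetP SG x.
        by case: (x \in S); case: (x \in G) => // ->.
      by rewrite !inE cardsD (setIidPr SG) Gm eqxx subsetDr.
    case=> B; rewrite inE => /andP[BS /eqP Bm] ->; split; first exact: subsetUr.
    by rewrite cardsU Bm disjoint_setI0 ?cards0 ?subn0 ?subnK// disjoints_subset.
  move=> B C; rewrite !inE => /andP[BS _] /andP[CS _] /setP BC; apply/setP => x.
  have := BC x; rewrite !inE.
  have := subsetP BS x; have := subsetP CS x; rewrite !inE.
  case: (x \in S); last by rewrite !orbF.
  by case: (x \in B) => [_ /(_ isT)|]; case: (x \in C) => // /(_ isT).
rewrite cards_draws cardsCs setCK.
apply/eqP; rewrite -(eqn_pmul2r (fact_gt0 (m - #|S|))); apply/eqP.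
rewrite -[RHS]mulnA (ffact_fact sm) bin_ffact mulnAC bin_ffact mulnC.
rewrite -{2}(subnKC sm); move: (m - #|S|)%N => k.
elim: k => [|k IH]; first by rewrite ffactn0 muln1 addn0.
by rewrite addnS !ffactnSr mulnA IH subnDA.
Qed.

Definition falling_ratio N m s : R := (m ^_ s)%:R / (N ^_ s)%:R.

Lemma sum_supersets S m :
  \sum_(G : {set T} | #|G| == m) (S \subset G)%:R
  = 'C(#|T|, m)%:R * falling_ratio #|T| m #|S|.
Proof.
have N0 : (#|T| ^_ #|S|)%:R != 0 :> R.
  by rewrite pnatr_eq0 -lt0n ffact_gt0 max_card.
apply: (mulIf N0); rewrite -mulrA divfK// -natrM -card_supersets natrM.
congr (_ * _); rewrite -sum1_card natr_sum big_mkcond/= [RHS]big_mkcond/=.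
by apply: eq_bigr => G _; rewrite inE; case: (_ \subset _); case: eqP.
Qed.

Definition members_in F G := #|[set M in F | M \subset G]|.

Lemma members_inE F G : (members_in F G)%:R = \sum_(M in F) (M \subset G)%:R :> R.
Proof.
rewrite /members_in -sum1_card natr_sum big_mkcond/= [RHS]big_mkcond/=.
by apply: eq_bigr => M _; rewrite !inE; case: (M \in F); case: (_ \subset _).
Qed.

Variables (F : {set {set T}}) (l : nat).
Hypothesis Fl : forall M, M \in F -> #|M| = l.

Lemma sum_members_in m :
  \sum_(G : {set T} | #|G| == m) (members_in F G)%:R
  = 'C(#|T|, m)%:R * (#|F|%:R * falling_ratio #|T| m l).
Proof.
under eq_bigr do rewrite members_inE.
rewrite exchange_big/=.
under eq_bigr => M MF do rewrite sum_supersets Fl//.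
by rewrite sumr_const -mulr_natl; ring.
Qed.

(** The square counts ordered pairs of members inside [G], and such a pair lies in [G] exactly when
    its union, of size [2 * l - #|M :&: M'|], does. *)
Lemma sum_sqr_members_in m :
  \sum_(G : {set T} | #|G| == m) (members_in F G)%:R ^+ 2
  = 'C(#|T|, m)%:R * \sum_(M in F) \sum_(M' in F)
      falling_ratio #|T| m (2 * l - #|M :&: M'|)%N.
Proof.
transitivity (\sum_(M in F) \sum_(M' in F) \sum_(G : {set T} | #|G| == m)
    (M :|: M' \subset G)%:R : R).
  under [RHS]eq_bigr do rewrite exchange_big/=.
  rewrite [RHS]exchange_big/=; apply: eq_bigr => G _.
  rewrite members_inE expr2 mulr_suml; apply: eq_bigr => M _.
  rewrite mulr_sumr; apply: eq_bigr => M' _.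
  by rewrite subUset -natrM mulnb.
rewrite mulr_sumr; apply: eq_bigr => M MF.
rewrite mulr_sumr; apply: eq_bigr => M' MF'.
by rewrite sum_supersets cardsU (Fl MF) (Fl MF') addnn mul2n.
Qed.

End supersets.

(** * Overlaps of matchings *)

Section matchings.
Import boot.fintype boot.finset.
Variable n : nat.
Implicit Types (M J : graph n) (e f : edge n).

Definition matchings k := [set M : graph n | is_matching M && (#|M| == k)].

Definition vertices M : {set 'I_n} := \bigcup_(f in M) val f.

Lemma matchingP M :
  reflect {in M &, forall e f, e != f -> [disjoint val e & val f]} (is_matching M).
Proof.
apply: (iffP forall_inP) => [H e f eM fM ef|H e eM].
  by have /forall_inP/(_ f fM) := H e eM; rewrite ef.
by apply/forall_inP => f fM; apply/implyP; exact: H.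
Qed.

Lemma sub_matching M J : J \subset M -> is_matching M -> is_matching J.
Proof.
move=> /subsetP JM /matchingP H; apply/matchingP => e f eJ fJ.
by apply: H; apply: JM.
Qed.

Lemma card_edge e : #|val e| = 2%N. Proof. exact/eqP/(valP e). Qed.

Lemma card_vertices M : is_matching M -> #|vertices M| = (2 * #|M|)%N.
Proof.
move=> /matchingP H.
have tI : trivIset (val @: M).
  apply/trivIsetP => _ _ /imsetP[e eM ->] /imsetP[f fM ->] ef.
  by apply: H => //; apply: contraNneq ef => ->.
have -> : vertices M = cover (val @: M) by rewrite cover_imset.
rewrite -(eqP tI) big_imset/=; last by move=> e f _ _; exact: val_inj.
under eq_bigr do rewrite card_edge.
by rewrite sum_nat_const mulnC.
Qed.

Lemma matchingU1 M e : is_matching M ->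
  ((e \notin M) && is_matching (e |: M)) = (val e \subset ~: vertices M).
Proof.
move=> mM; rewrite -disjoints_subset; apply/andP/idP => [[eM /matchingP H]|eV].
  apply/bigcup_disjointP => f fM; apply: H.
  - exact: setU11.
  - by rewrite setU1r.
  - by apply: contraNneq eM => ->.
have dis f : f \in M -> [disjoint val e & val f].
  move=> fM; have fV : val f \subset vertices M by exact: (bigcup_sup f).
  exact: disjointWr fV eV.
split.
  apply/negP => /dis; rewrite -setI_eq0 setIid => /eqP e0.
  by have := card_edge e; rewrite e0 cards0.
apply/matchingP => g h; rewrite !inE => /orP[/eqP->|gM] /orP[/eqP->|hM].
- by rewrite eqxx.
- by move=> _; exact: dis.
- by move=> _; rewrite disjoint_sym; exact: dis.
- by move/matchingP : mM; exact.
Qed.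

(** An extending edge is any pair of uncovered vertices. The count depends on [M] only through its
    size, which keeps all later counts exact. *)
Lemma card_matching_extensions M : is_matching M ->
  #|[set e | (e \notin M) && is_matching (e |: M)]| = 'C(n - 2 * #|M|, 2).
Proof.
move=> mM.
have -> : #|[set e | (e \notin M) && is_matching (e |: M)]|
    = #|[set B : {set 'I_n} | B \subset ~: vertices M & #|B| == 2%N]|.
  rewrite -(card_imset _ val_inj); apply: eq_card => B; rewrite !inE.
  apply/imsetP/andP => [[e]|[BV B2]].
    by rewrite inE matchingU1// => eV ->; rewrite eV; split => //; exact: (valP e).
  exists (exist _ B B2 : edge n) => //.
  by rewrite inE matchingU1.
by rewrite cards_draws cardsCs setCK card_ord card_vertices.
Qed.

Definition matchings_over J k := #|[set M in matchings k | J \subset M]|.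

(* Both sides count the pairs (M, e) with M a k-matching containing J and e an
   edge extending M to a matching. *)
Lemma matchings_over_rec J k : (#|J| <= k)%N ->
  (matchings_over J k.+1 * (k.+1 - #|J|) = matchings_over J k * 'C(n - 2 * k, 2))%N.
Proof.
move=> Jk.
transitivity (\sum_(M in [set M in matchings k.+1 | J \subset M])
                \sum_(e | e \in M :\: J) 1)%N.
  rewrite /matchings_over -sum_nat_const; apply: eq_bigr => M.
  rewrite !inE => /andP[/andP[_ /eqP Mk] JM].
  by rewrite sum1_card cardsD (setIidPr JM) Mk.
transitivity (\sum_(M in [set M in matchings k | J \subset M])
    \sum_(e | (e \notin M) && is_matching (e |: M)) 1)%N; last first.
  rewrite /matchings_over -sum_nat_const; apply: eq_bigr => M.
  rewrite !inE => /andP[/andP[mM /eqP Mk] JM].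
  by rewrite -Mk -card_matching_extensions// -sum1_card; apply: eq_bigl => e; rewrite inE.
rewrite (exchange_big_dep xpredT)//= [RHS](exchange_big_dep xpredT)//=.
apply: eq_bigr => e _.
rewrite (reindex_onto (fun M => e |: M) (fun M => M :\ e)) => [|M]; last first.
  by rewrite !inE => /andP[_ /andP[_ eM]]; rewrite setD1K.
apply: eq_bigl => M; rewrite !inE eqxx/= andbT.
have [eM|eM] := boolP (e \in M).
  rewrite andbF; apply/negbTE/negP => /andP[_ /eqP H].
  by move: eM; rewrite -H !inE eqxx.
have -> : (e |: M) :\ e == M by rewrite setU1K.
rewrite cardsU1 eM add1n eqSS andbT/=.
have [eJ|eJ] := boolP (e \in J).
  rewrite andbF; apply/esym/negbTE/negP => /andP[/andP[_ /subsetP/(_ e eJ)]].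
  by rewrite (negbTE eM).
have -> : (J \subset e |: M) = (J \subset M).
  apply/idP/idP => [/subsetP H|H]; last exact: subset_trans H (subsetUr _ _).
  apply/subsetP => f fJ; have := H f fJ; rewrite !inE => /orP[/eqP fe|//].
  by rewrite -fe fJ in eJ.
have [mU|mU] := boolP (is_matching (e |: M)); last by rewrite !andbF.
by rewrite (sub_matching (subsetUr _ _) mU) andbT.
Qed.

(** This counts ordered tuples of [j] pairwise disjoint edges, that is j! times the number of
    [j]-matchings. *)
Definition extension_count j := (\prod_(i < j) 'C(n - 2 * i, 2))%N.

(** The ordered completions of [J] to size [l] number the product of the factors of
    [extension_count l] with index at least [#|J|]; multiplying by the missing factors avoids a
    division. *)
Lemma matchings_overE J l : is_matching J -> (#|J| <= l)%N ->
  (matchings_over J l * (l - #|J|)`! * extension_count #|J| = extension_count l)%N.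
Proof.
move=> mJ; elim: l => [|l IH].
  rewrite leqn0 => /eqP J0; rewrite J0 /extension_count big_ord0 !muln1.
  have -> : J = set0 by apply/eqP; rewrite -cards_eq0 J0.
  rewrite /matchings_over (_ : [set _ in _ | _] = [set set0]) ?cards1//.
  apply/setP => M; rewrite !inE sub0set andbT cards_eq0.
  apply/andP/eqP => [[_ /eqP]//|->]; split=> //.
  by apply/matchingP => e f; rewrite inE.
rewrite leq_eqVlt => /orP[/eqP Jl|]; last first.
  rewrite ltnS => Jl; rewrite subSn// factS -subSn// mulnA matchings_over_rec//.
  rewrite -[LHS]mulnA mulnAC mulnA IH// /extension_count.
  by rewrite big_ord_recr.
rewrite Jl subnn !muln1.
rewrite /matchings_over (_ : [set _ in _ | _] = [set J]) ?cards1 ?mul1n//.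
apply/setP => M; rewrite !inE; apply/idP/eqP => [/andP[/andP[_ /eqP Ml]] JM|->].
  by apply/esym/eqP; rewrite eqEcard JM Ml Jl /=.
by rewrite mJ Jl eqxx subxx.
Qed.

Lemma card_matchings l : (#|matchings l| * l`! = extension_count l)%N.
Proof.
have /matchings_overE : is_matching (set0 : graph n).
  by apply/matchingP => e f; rewrite inE.
rewrite cards0 => /(_ l (leq0n l)); rewrite subn0 /extension_count big_ord0 muln1.
move=> <-; congr (_ * _)%N; apply: eq_card => M.
by rewrite !inE sub0set andbT.
Qed.

Lemma matchings_over_card J l : is_matching J -> (#|J| <= l)%N ->
  (matchings_over J l * extension_count #|J| = #|matchings l| * l ^_ #|J|)%N.
Proof.
move=> mJ Jl; apply/eqP; rewrite -(eqn_pmul2r (fact_gt0 (l - #|J|))); apply/eqP.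
by rewrite mulnAC matchings_overE// -mulnA ffact_fact// card_matchings.
Qed.

(** The binomial coefficient counts the [j]-sets [J] common to both matchings. Fixing [M], then one
    of its 'C(l, j) subsets [J], leaves the number of [l]-matchings over [J], which depends only on
    [j]. *)
Lemma sum_overlaps l j :
  ((\sum_(M in matchings l) \sum_(M' in matchings l) 'C(#|M :&: M'|, j))
    * extension_count j * j`! = (#|matchings l| * l ^_ j) ^ 2)%N.
Proof.
have H M : M \in matchings l ->
  ((\sum_(M' in matchings l) 'C(#|M :&: M'|, j)) * extension_count j
   = 'C(l, j) * (#|matchings l| * l ^_ j))%N.
  rewrite inE => /andP[mM /eqP Ml].
  transitivity ((\sum_(J : graph n | (J \subset M) && (#|J| == j))
       matchings_over J l) * extension_count j)%N.
    congr (_ * _)%N.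
    transitivity (\sum_(M' in matchings l)
        \sum_(J : graph n | (J \subset M) && (#|J| == j)) (J \subset M'))%N.
      apply: eq_bigr => M' _; rewrite -cards_draws -sum1_card big_mkcond/=.
      rewrite [RHS]big_mkcond/=; apply: eq_bigr => J _; rewrite !inE subsetI.
      by case: (J \subset M); case: (J \subset M'); case: (_ == _).
    rewrite exchange_big/=; apply: eq_bigr => J _.
    rewrite /matchings_over -sum1_card big_mkcond/= [RHS]big_mkcond/=.
    by apply: eq_bigr => M' _; rewrite !inE; case: ifP => //; case: (_ \subset _).
  have [jl|lj] := leqP j l; last first.
    rewrite bin_small// big_pred0 ?mul0n// => J; apply/negP => /andP[/subset_leq_card].
    by rewrite Ml => Jl /eqP Jj; rewrite Jj leqNgt lj in Jl.
  rewrite big_distrl/=.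
  transitivity (\sum_(J : graph n | (J \subset M) && (#|J| == j))
                  (#|matchings l| * l ^_ j))%N.
    apply: eq_bigr => J /andP[JM /eqP Jj].
    by rewrite -Jj matchings_over_card ?Jj//; exact: sub_matching mM.
  rewrite sum_nat_const -Ml -cards_draws; congr (_ * _)%N.
  by apply: eq_card => J; rewrite inE.
rewrite big_distrl/= (eq_bigr _ H) sum_nat_const -bin_ffact; ring.
Qed.

(** The ratio (l - i) / l is at most (n - 2i) / n and also at most (n - 2i - 1) / (n - 1); the
    second bound uses the strict inequality 2l < n. Their product is the claim. *)
Lemma leq_overlap_factor l i : (2 * l < n)%N -> (i < l)%N ->
  ((l - i) ^ 2 * 'C(n, 2) <= 'C(n - 2 * i, 2) * l ^ 2)%N.
Proof.
move=> ln il.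
rewrite -(leq_pmul2r (fact_gt0 2)) -mulnA bin_ffact mulnAC bin_ffact.
rewrite !ffactnS !ffactn0 !muln1 -!subn1.
have H1 : ((l - i) * n <= l * (n - 2 * i))%N by nia.
have H2 : ((l - i) * (n - 1) <= l * (n - 2 * i - 1))%N by nia.
have := leq_mul H1 H2; congr (_ <= _)%N; ring.
Qed.

Lemma leq_overlap l j : (2 * l < n)%N -> (j <= l)%N ->
  ((l ^_ j) ^ 2 * 'C(n, 2) ^ j <= extension_count j * (l ^ 2) ^ j)%N.
Proof.
move=> ln; elim: j => [|j IH] jl; first by rewrite /extension_count big_ord0.
rewrite ffactnSr expnMn (expnSr 'C(n, 2)) (expnSr (l ^ 2)) /extension_count big_ord_recr/=.
have := leq_mul (IH (ltnW jl)) (leq_overlap_factor ln jl).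
by congr (_ <= _)%N; rewrite /extension_count; ring.
Qed.

Lemma sum_overlaps_le (R : realType) l j : (2 * l < n)%N ->
  \sum_(M in matchings l) \sum_(M' in matchings l) 'C(#|M :&: M'|, j)%:R
  <= #|matchings l|%:R ^+ 2 * (l%:R ^+ 2 / 'C(n, 2)%:R) ^+ j / j`!%:R :> R.
Proof.
move=> ln.
have -> : \sum_(M in matchings l) \sum_(M' in matchings l) 'C(#|M :&: M'|, j)%:R
  = (\sum_(M in matchings l) \sum_(M' in matchings l) 'C(#|M :&: M'|, j))%:R :> R.
  by rewrite natr_sum; apply: eq_bigr => M _; rewrite natr_sum.
have [jl|lj] := leqP j l; last first.
  rewrite big1 ?mulr_ge0 ?invr_ge0 ?exprn_ge0 ?divr_ge0 ?ler0n// => M.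
  rewrite inE => /andP[_ /eqP Ml]; apply: big1 => M' _; apply: bin_small.
  by rewrite (leq_ltn_trans _ lj)// -Ml subset_leq_card// subsetIl.
have Q0 : (0 < extension_count j)%N.
  apply: prodn_gt0 => i; rewrite bin_gt0.
  by have := ltn_ord i; lia.
(* For l = 0 the number of edge slots 'C(n, 2) may vanish, so this case is settled before dividing
   by it. *)
have [l0|l0] := posnP l.
  move: jl; rewrite l0 leqn0 => /eqP ->.
  have := sum_overlaps 0 0.
  rewrite /extension_count big_ord0 ffactn0 !muln1 expr0 mulr1 => ->.
  by rewrite natrX divr1.
have N0 : (0 < 'C(n, 2))%N by rewrite bin_gt0; lia.
rewrite expr_div_n mulrA -mulrA -invfM.
have := sum_overlaps l j; set S := (\sum_(M in _) _)%N => HS.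
rewrite ler_pdivlMr ?mulr_gt0 ?exprn_gt0 ?ltr0n ?fact_gt0//.
rewrite -!natrX -!natrM ler_nat.
rewrite -(leq_pmul2r Q0).
have -> : (S * ('C(n, 2) ^ j * j`!) * extension_count j
  = #|matchings l| ^ 2 * ((l ^_ j) ^ 2 * 'C(n, 2) ^ j))%N.
  transitivity (S * extension_count j * j`! * 'C(n, 2) ^ j)%N; first by ring.
  by rewrite HS expnMn; ring.
rewrite -mulnA leq_mul2l [X in _ || (_ <= X)%N]mulnC.
by apply/orP; right; exact: leq_overlap.
Qed.

Lemma card_matchings_gt0 l : (2 * l < n)%N -> (0 < #|matchings l|)%N.
Proof.
move=> ln; rewrite -(ltn_pmul2r (fact_gt0 l)) mul0n card_matchings.
apply: prodn_gt0 => i; rewrite bin_gt0.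
by have := ltn_ord i; lia.
Qed.

End matchings.

(** * Second moment given the number of edges *)

Section second_moment.
Variable R : realType.

Lemma sum_expr_fact_le (x : R) k : 0 <= x ->
  \sum_(j < k) x ^+ j / j`!%:R <= expR x.
Proof.
move=> x0; have := nondecreasing_cvgn_le _ (is_cvg_series_exp_coeff x) k.
rewrite /series/= /exp_coeff/= /expR big_mkord; apply.
apply/nondecreasing_seqP => i; rewrite /series/= big_nat_recr//= lerDl.
by rewrite mulr_ge0 ?exprn_ge0// invr_ge0.
Qed.

Lemma falling_ratioS N m s : falling_ratio R N m s.+1
  = falling_ratio R N m s * ((m - s)%N%:R / (N - s)%N%:R).
Proof. by rewrite /falling_ratio !ffactnSr !natrM invfM; ring. Qed.

Lemma falling_ratio_ge0 N m s : 0 <= falling_ratio R N m s.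
Proof. by rewrite mulr_ge0// invr_ge0. Qed.

Lemma falling_ratio_gt0 N m s : (s <= m)%N -> (m <= N)%N ->
  0 < falling_ratio R N m s.
Proof.
by move=> sm mN; rewrite divr_gt0 ?ltr0n ?ffact_gt0// (leq_trans sm).
Qed.

(** Lowering the index to s multiplies the ratio by (N - s) / (m - s), which grows with s because m
    <= N; each of the [k] factors is bounded by its value at [2 * l]. *)
Lemma falling_ratio_sub_le N m l k : (2 * l < m)%N -> (m <= N)%N -> (k <= l)%N ->
  falling_ratio R N m (2 * l - k) <= falling_ratio R N m (2 * l)
     * ((N - 2 * l)%:R / (m - 2 * l)%:R) ^+ k.
Proof.
move=> lm mN; set a : R := _ / _.
elim: k => [|k IH] kl; first by rewrite subn0 expr0 mulr1.
apply: le_trans (_ : falling_ratio R N m (2 * l - k) * a <= _); last first.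
  by rewrite exprSr [leRHS]mulrA ler_wpM2r ?divr_ge0// IH// ltnW.
have -> : (2 * l - k = (2 * l - k.+1).+1)%N by lia.
rewrite falling_ratioS; set s := (2 * l - k.+1)%N.
have ms : 0 < (m - s)%N%:R :> R by rewrite ltr0n /s; lia.
have Ns : 0 < (N - s)%N%:R :> R by rewrite ltr0n /s; lia.
have ml : 0 < (m - 2 * l)%N%:R :> R by rewrite ltr0n; lia.
rewrite -mulrA ler_peMr ?falling_ratio_ge0//.
rewrite /a mulf_div ler_pdivlMr ?mulr_gt0// mul1r -!natrM ler_nat /s.
by nia.
Qed.

(** Containing one set of [l] edges uses up edges and makes a second, disjoint set less likely. The
    exponential gain is kept because it has to cancel the main contribution of the overlaps. *)
Lemma falling_ratio_double_le N m l : (2 * l < m)%N -> (m <= N)%N ->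
  falling_ratio R N m (2 * l) <= falling_ratio R N m l ^+ 2
    * expR (- (l%:R ^+ 2 * (N - m)%:R / (m%:R * N%:R))).
Proof.
move=> lm mN.
have m0 : 0 < m%:R :> R by rewrite ltr0n; lia.
have N0 : 0 < N%:R :> R by rewrite ltr0n; lia.
set t : R := l%:R * (N - m)%:R / (m%:R * N%:R).
(* With [l] fixed, the factor of index l + k is compared with the factor of index k; each comparison
   gains at least 1 - t. *)
suff H k : (k <= l)%N -> falling_ratio R N m (l + k)
    <= falling_ratio R N m l * falling_ratio R N m k * expR (- (k%:R * t)).
  have := H l (leqnn l); rewrite addnn -mul2n expr2; congr (_ <= _ * expR _).
  by rewrite /t; ring.
elim: k => [|k IH] kl.
  by rewrite addn0 mul0r oppr0 expR0 /falling_ratio !ffactn0 divr1 !mulr1.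
rewrite addnS !falling_ratioS.
have -> : falling_ratio R N m l * (falling_ratio R N m k * ((m - k)%N%:R / (N - k)%N%:R))
    * expR (- (k.+1%:R * t))
  = falling_ratio R N m l * falling_ratio R N m k * expR (- (k%:R * t))
    * ((m - k)%N%:R / (N - k)%N%:R * expR (- t)).
  by rewrite -natr1 mulrDl mul1r opprD expRD; ring.
apply: ler_pM; rewrite ?falling_ratio_ge0 ?divr_ge0// ?IH 1?ltnW//.
apply: le_trans (_ : (m - k)%N%:R / (N - k)%N%:R * (1 - t) <= _); last first.
  by rewrite ler_wpM2l ?divr_ge0// expR_ge1Dx.
have mk : 0 < (m - k)%N%:R :> R by rewrite ltr0n; lia.
have Nk : 0 < (N - k)%N%:R :> R by rewrite ltr0n; lia.
have Nlk : 0 < (N - (l + k))%N%:R :> R by rewrite ltr0n; lia.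
rewrite ler_pdivrMr//.
have tE : t * (m%:R * N%:R) = l%:R * (N - m)%:R by rewrite /t divfK// gt_eqF// mulr_gt0.
have t0 : 0 <= t by rewrite /t divr_ge0// mulr_ge0.
have : (l%:R * (N - m)%:R) / ((m - k)%N%:R * (N - (l + k))%N%:R) >= t.
  rewrite /t ler_wpM2l ?mulr_ge0// lef_pV2 ?posrE ?mulr_gt0//.
  by rewrite -!natrM ler_nat leq_mul ?leq_subr.
(* [u] is the exact relative defect: (m - l - k)(N - k) = (m - k)(N - l - k)(1 - u). *)
set u := _ / _ => tu.
apply: le_trans (_ : (m - k)%N%:R / (N - k)%N%:R * (1 - u)
  * (N - (l + k))%:R <= _); last first.
  by rewrite ler_wpM2r// ler_wpM2l ?divr_ge0// lerB.
rewrite le_eqVlt; apply/orP; left; apply/eqP.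
rewrite /u.
have e1 : (m - (l + k))%N%:R = m%:R - l%:R - k%:R :> R by rewrite natrB ?natrD; [ring|lia].
have e2 : (N - (l + k))%N%:R = N%:R - l%:R - k%:R :> R by rewrite natrB ?natrD; [ring|lia].
move: mk Nk Nlk; rewrite e1 e2 !natrB//; try lia.
move=> mk Nk Nlk; field; rewrite !gt_eqF//.
Qed.

(** The two terms of order L^2 / M cancel: the difference is exactly the right-hand side times (N -
    M) / N. *)
Lemma second_moment_exponent (L M N : R) : 0 <= L -> 2 * L < M -> M <= N ->
  (N - M) / (M - 2 * L) * (L ^+ 2 / N) - L ^+ 2 * (N - M) / (M * N)
  <= 2 * L ^+ 3 / (M * (M - 2 * L)).
Proof.
move=> L0 LM MN; have M0 : 0 < M by lra.
have N0 : 0 < N by lra.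
have D0 : 0 < M - 2 * L by lra.
have -> : (N - M) / (M - 2 * L) * (L ^+ 2 / N) - L ^+ 2 * (N - M) / (M * N)
   = 2 * L ^+ 3 / (M * (M - 2 * L)) * ((N - M) / N).
  by field; rewrite !gt_eqF.
apply: ler_piMr; last by rewrite ler_pdivrMr// mul1r; lra.
by rewrite divr_ge0 ?mulr_ge0 ?exprn_ge0// ltW.
Qed.

Lemma sum_falling_ratio_overlap_le n m l : (2 * l < n)%N -> (2 * l < m)%N ->
  (m <= 'C(n, 2))%N ->
  \sum_(M in matchings n l) \sum_(M' in matchings n l)
    falling_ratio R 'C(n, 2) m (2 * l - #|finset.setI M M'|)
  <= (#|matchings n l|%:R * falling_ratio R 'C(n, 2) m l) ^+ 2
     * expR (2 * l%:R ^+ 3 / (m%:R * (m%:R - 2 * l%:R))).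
Proof.
move=> ln lm; set N := 'C(n, 2) => mN.
have D0 : 0 < (m%:R - 2 * l%:R) :> R by rewrite -natrM -natrB ?ltr0n; lia.
have m0 : 0 < m%:R :> R by rewrite ltr0n; lia.
have N0 : 0 < N%:R :> R by rewrite ltr0n; lia.
(* Each shared edge costs a factor 1 + b = (N - 2l) / (m - 2l). Expanding the power in binomial
   coefficients of the overlap makes the bounds of [sum_overlaps_le] applicable, and their sum is an
   exponential series. *)
set b : R := (N%:R - m%:R) / (m%:R - 2 * l%:R).
have mN' : m%:R <= N%:R :> R by rewrite ler_nat.
have b0 : 0 <= b by apply: divr_ge0; [rewrite subr_ge0|exact: ltW].
have aE : (N - 2 * l)%:R / (m - 2 * l)%:R = 1 + b.
  rewrite /b !natrB ?natrM; [|lia..].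
  by field; rewrite gt_eqF.
apply: le_trans (_ : \sum_(M in matchings n l) \sum_(M' in matchings n l)
   falling_ratio R N m (2 * l) * \sum_(j < l.+1) b ^+ j * 'C(#|finset.setI M M'|, j)%:R <= _).
  apply: ler_sum => M; rewrite inE => /andP[_ /eqP Ml].
  apply: ler_sum => M' _; set k := #|_|.
  have kl : (k <= l)%N by rewrite -Ml subset_leq_card// finset.subsetIl.
  apply: le_trans (falling_ratio_sub_le lm mN kl) _.
  rewrite aE ler_wpM2l ?falling_ratio_ge0//.
  rewrite exprDn (big_ord_widen l.+1 (fun i => (1 ^+ (k - i) * b ^+ i) *+ 'C(k, i)))//.
  rewrite big_mkcond/=; apply: ler_sum => i _.
  by rewrite expr1n mul1r -mulr_natr; case: ifP => // _; rewrite mulr_ge0 ?exprn_ge0.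
have -> : \sum_(M in matchings n l) \sum_(M' in matchings n l)
   falling_ratio R N m (2 * l) * \sum_(j < l.+1) b ^+ j * 'C(#|finset.setI M M'|, j)%:R
  = falling_ratio R N m (2 * l) * \sum_(j < l.+1) b ^+ j *
     \sum_(M in matchings n l) \sum_(M' in matchings n l) 'C(#|finset.setI M M'|, j)%:R.
  under eq_bigr do rewrite -mulr_sumr exchange_big/=.
  rewrite -mulr_sumr exchange_big/=; congr (_ * _); apply: eq_bigr => j _.
  by rewrite mulr_sumr; apply: eq_bigr => M _; rewrite mulr_sumr.
set f : R := #|matchings n l|%:R.
have S : \sum_(j < l.+1) b ^+ j * \sum_(M in matchings n l)
      \sum_(M' in matchings n l) 'C(#|finset.setI M M'|, j)%:R
    <= f ^+ 2 * expR (b * (l%:R ^+ 2 / N%:R)).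
  apply: le_trans (_ : f ^+ 2 * \sum_(j < l.+1) (b * (l%:R ^+ 2 / N%:R)) ^+ j / j`!%:R <= _).
    rewrite mulr_sumr; apply: ler_sum => j _.
    have := sum_overlaps_le R j ln => /(ler_wpM2l (exprn_ge0 j b0)) /le_trans; apply.
    by rewrite [(b * _) ^+ _]exprMn -/f -/N le_eqVlt; apply/orP; left; apply/eqP; ring.
  rewrite ler_wpM2l ?exprn_ge0// sum_expr_fact_le//.
  by rewrite mulr_ge0// divr_ge0// exprn_ge0.
apply: le_trans (ler_pM _ _ (falling_ratio_double_le lm mN) S) _.
- exact: falling_ratio_ge0.
- apply: sumr_ge0 => j _; rewrite mulr_ge0 ?exprn_ge0//.
  by apply: sumr_ge0 => M _; apply: sumr_ge0.
set r := falling_ratio R N m l.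
have -> : r ^+ 2 * expR (- (l%:R ^+ 2 * (N - m)%:R / (m%:R * N%:R)))
    * (f ^+ 2 * expR (b * (l%:R ^+ 2 / N%:R)))
  = (f * r) ^+ 2 * expR (b * (l%:R ^+ 2 / N%:R) - l%:R ^+ 2 * (N%:R - m%:R) / (m%:R * N%:R)).
  by rewrite expRD natrB//; ring.
rewrite ler_wpM2l ?exprn_ge0 ?mulr_ge0 ?falling_ratio_ge0//.
by rewrite ler_expR /b second_moment_exponent//; lra.
Qed.

End second_moment.

(** * Moments of the edge count in the binomial random graph *)

Section gnp_moments.
Import boot.fintype boot.finset.
Variables (R : realType) (n : nat) (p : R).
Hypothesis p01 : 0 <= p <= 1.
Implicit Types (G S M : graph n) (e f : edge n).

Let N := 'C(n, 2).

Lemma card_edges : #|{: edge n}| = 'C(n, 2).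
Proof.
rewrite card_sig -[in RHS](card_ord n) -card_draws.
by apply: eq_card => e; rewrite !inE.
Qed.

Lemma gnp_pmfE G : gnp_pmf p G = p ^+ #|G| * (1 - p) ^+ ('C(n, 2) - #|G|).
Proof.
rewrite /gnp_pmf (bigID (mem G))/=.
rewrite (eq_bigr (fun=> p)) => [|e /= ->//].
rewrite [X in _ * X](eq_bigr (fun=> 1 - p)) => [|e /= /negbTE->//].
rewrite !prodr_const; congr (_ * _ ^+ _).
by rewrite -card_edges -(cardC (mem G)) addKn; apply: eq_card => e; rewrite !inE.
Qed.

Lemma gnp_probE (A : set (graph n)) :
  gnp_prob n p A = (\sum_(G : graph n | G \in A) gnp_pmf p G)%:E.
Proof.
rewrite /gnp_prob p01 fsbig_finite//= sumEFin; congr EFin.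
rewrite -[RHS]big_filter; apply: perm_big; apply: uniq_perm => [||G].
- exact: finmap.fset_uniq.
- by rewrite filter_uniq ?index_enum_uniq.
- rewrite in_fset_set; last exact: finite_finset.
  by rewrite mem_filter mem_index_enum andbT.
Qed.

(** The indicator of [S \subset G] is a product over the edges, so the sum over all graphs
    factorises into p for an edge of [S] and 1 for any other edge. *)
Lemma sum_gnp_pmf_supset S :
  \sum_(G : graph n) gnp_pmf p G * (S \subset G)%:R = p ^+ #|S|.
Proof.
pose F e b : R := bernoulli_pmf p b * ((e \in S) ==> b)%:R.
have := @bigA_distr_bigA R 0 1 *%R +%R (edge n) bool F.
rewrite (eq_bigr (fun e => if e \in S then p else 1)) => [|e _]; last first.
  rewrite big_bool/= /F /bernoulli_pmf; case: (e \in S) => /=.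
    by rewrite mulr1 mulr0 addr0.
  by rewrite !mulr1 subrKC.
rewrite -big_mkcond/= prodr_const => ->.
pose h (f : {ffun edge n -> bool}) : graph n := finset (fun e => f e).
pose k (G : graph n) : {ffun edge n -> bool} := [ffun e => e \in G].
rewrite (reindex h)/=; last first.
  exists k => [f _|G _]; first by apply/ffunP => e; rewrite ffunE inE.
  by apply/setP => e; rewrite inE ffunE.
apply: eq_bigr => f _; rewrite /F big_split/=; congr (_ * _).
  by apply: eq_bigr => e _; rewrite inE.
have [/subsetP Sf|/subsetPn[e eS ef]] := boolP (S \subset h f).
  rewrite big1// => e _; case eS: (e \in S) => //=.
  by have := Sf e eS; rewrite inE => ->.
rewrite (bigD1 e)//= eS/=; rewrite inE in ef.
by rewrite (negbTE ef) mul0r.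
Qed.

Lemma sum_gnp_pmf_card : \sum_(G : graph n) gnp_pmf p G * #|G|%:R = p * N%:R.
Proof.
transitivity (\sum_(e : edge n) \sum_(G : graph n) gnp_pmf p G * ([set e] \subset G)%:R).
  rewrite exchange_big/=; apply: eq_bigr => G _; rewrite -mulr_sumr; congr (_ * _).
  rewrite -sum1_card natr_sum big_mkcond/=; apply: eq_bigr => e _.
  by rewrite sub1set; case: (e \in G).
under eq_bigr do rewrite sum_gnp_pmf_supset cards1 expr1.
by rewrite sumr_const card_edges mulr_natr.
Qed.

Lemma sum_gnp_pmf_card2 :
  \sum_(G : graph n) gnp_pmf p G * #|G|%:R ^+ 2 = N%:R * p * (1 - p) + (p * N%:R) ^+ 2.
Proof.
transitivity (\sum_(e : edge n) \sum_(f : edge n)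
    \sum_(G : graph n) gnp_pmf p G * ([set e; f] \subset G)%:R).
  under [RHS]eq_bigr do rewrite exchange_big/=.
  rewrite exchange_big/=; apply: eq_bigr => G _.
  under [RHS]eq_bigr do rewrite -mulr_sumr.
  rewrite -mulr_sumr; congr (_ * _).
  have -> : #|G|%:R = \sum_e (e \in G)%:R :> R.
    rewrite -sum1_card natr_sum big_mkcond/=; apply: eq_bigr => e _.
    by case: (e \in G).
  rewrite expr2 mulr_suml; apply: eq_bigr => e _.
  rewrite mulr_sumr; apply: eq_bigr => f _.
  by rewrite subUset !sub1set -natrM mulnb.
(* For a fixed e, the diagonal term p and the N - 1 terms p^2 add up to p (1 - p) + N p^2. *)
transitivity (\sum_(e : edge n) (p * (1 - p) + N%:R * p ^+ 2)).
  apply: eq_bigr => e _; rewrite (bigD1 e)//= sum_gnp_pmf_supset setUid cards1.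
  rewrite (eq_bigr (fun=> p ^+ 2)) => [|f fe]; last first.
    by rewrite sum_gnp_pmf_supset cards2 eq_sym fe.
  rewrite sumr_const /=.
  have -> : #|[pred f | f != e]| = (N - 1)%N.
    by rewrite /N -card_edges -(cardC (pred1 e)) card1 add1n subn1.
  have N0 : (0 < N)%N by rewrite /N -card_edges; apply/card_gt0P; exists e.
  by rewrite -[_ *+ (N - 1)]mulr_natl natrB//; ring.
rewrite sumr_const card_edges -[LHS]mulr_natl -/N; ring.
Qed.

Lemma gnp_card_variance :
  \sum_(G : graph n) gnp_pmf p G * (#|G|%:R - p * N%:R) ^+ 2 = N%:R * p * (1 - p).
Proof.
transitivity (\sum_(G : graph n) gnp_pmf p G * #|G|%:R ^+ 2
   - 2 * (p * N%:R) * (\sum_(G : graph n) gnp_pmf p G * #|G|%:R)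
   + (p * N%:R) ^+ 2 * (\sum_(G : graph n) gnp_pmf p G)).
  rewrite !mulr_sumr -sumrB -big_split/=; apply: eq_bigr => G _; ring.
rewrite sum_gnp_pmf_card sum_gnp_pmf_card2 gnp_pmf_sum1; ring.
Qed.

Lemma gnp_card_chebyshev (A : R) : 0 < A ->
  \sum_(G : graph n | A ^+ 2 * (N%:R * p * (1 - p)) < (#|G|%:R - p * N%:R) ^+ 2) gnp_pmf p G
  <= A ^- 2.
Proof.
move=> A0; set v := N%:R * p * (1 - p).
have v0 : 0 <= v by case/andP: p01 => *; rewrite !mulr_ge0// subr_ge0.
have w0 G : 0 <= gnp_pmf p G by exact: gnp_pmf_ge0.
(* When the variance vanishes, every graph whose edge count differs from the mean has weight
   zero. *)
have [v00|vn0] := eqVneq v 0.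
  rewrite v00 mulr0 big1 ?invr_ge0 ?exprn_ge0 ?ltW// => G HG.
  have /eqP : \sum_(G : graph n) gnp_pmf p G * (#|G|%:R - p * N%:R) ^+ 2 = 0.
    by rewrite gnp_card_variance.
  rewrite psumr_eq0 => [/allP/(_ G (mem_index_enum _))/=|G' _].
    by rewrite mulf_eq0 (gt_eqF HG) orbF => /eqP.
  by rewrite mulr_ge0// sqr_ge0.
have vp : 0 < v by rewrite lt_def vn0.
have Av : 0 < A ^+ 2 * v by rewrite mulr_gt0// exprn_gt0.
have -> : A ^- 2 = v / (A ^+ 2 * v) by field; rewrite vn0 gt_eqF.
rewrite ler_pdivlMr//.
rewrite -[leRHS]gnp_card_variance mulr_suml big_mkcond/=.
apply: ler_sum => G _; case: ifPn => [/ltW H|_].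
  by rewrite ler_wpM2l.
by rewrite mulr_ge0// sqr_ge0.
Qed.

Lemma sum_gnp_pmf_eqcard k :
  \sum_(G : graph n | #|G| == k) gnp_pmf p G = binomial_pmf N p k.
Proof.
rewrite (eq_bigr (fun=> p ^+ k * (1 - p) ^+ (N - k))) => [|G /eqP <-]; last first.
  exact: gnp_pmfE.
rewrite sumr_const /binomial_pmf; congr (_ *+ _).
by rewrite /N -card_edges -card_draws; apply: eq_card => G; rewrite !inE.
Qed.

End gnp_moments.

(** * Concentration of the number of matchings around its conditional mean *)

Section concentration.
Import boot.fintype boot.finset.
Variables (R : realType) (n : nat) (p : R) (l : nat).
Hypothesis p01 : 0 <= p <= 1.
Implicit Types (G S M : graph n).

Lemma num_matchingsE G : num_matchings l G = members_in (matchings n l) G.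
Proof. by apply: eq_card => M; rewrite !inE andbA. Qed.

Lemma size_matchings M : M \in matchings n l -> #|M| = l.
Proof. by rewrite inE => /andP[_ /eqP]. Qed.

Lemma gnp_mean_matchings : gnp_mean n p l = #|matchings n l|%:R * p ^+ l.
Proof.
rewrite /gnp_mean unlock.
transitivity (fine (\int[gnp_prob n p]_G \sum_(M <- enum (matchings n l))
    (\1_[set` [pred G : graph n | M \subset G]] G)%:E)).
  congr fine; apply: eq_integral => G _ /=.
  rewrite num_matchingsE members_inE sumEFin big_enum/=; congr EFin.
  apply: eq_bigr => M _; rewrite indicE; congr (_ %:R).
  by case: (boolP (M \subset G)) => H; [rewrite mem_set|rewrite memNset//= ; apply/negP].
rewrite ge0_integral_sum//.
rewrite (eq_bigr (fun M => (p ^+ #|M|)%:E)) => [|M _]; last first.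
  rewrite integral_indic// classical_sets.setIT; apply: etrans; first exact: gnp_probE.
  congr EFin.
  rewrite -sum_gnp_pmf_supset big_mkcond/=; apply: eq_bigr => G _.
  have [H|H] := boolP (M \subset G).
    by rewrite mem_set// mulr1.
  by rewrite memNset ?mulr0//=; apply/negP.
rewrite sumEFin/= big_enum/= (eq_bigr (fun=> p ^+ l)) => [|M /size_matchings ->//].
by rewrite sumr_const mulr_natl.
Qed.

Hypothesis ln : (2 * l < n)%N.

Let N := 'C(n, 2).

Definition conditional_mean m : R :=
  #|matchings n l|%:R * falling_ratio R 'C(n, 2) m l.

(** All graphs with m edges have the same weight, so this is Chebyshev's inequality for the uniform
    model, with relative variance at most the exponential minus 1. The factor [binomial_pmf N p m]
    makes the bounds summable over m. *)
Lemma deviation_given_size (eps : R) m : 0 < eps -> (2 * l < m)%N -> (m <= N)%N ->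
  \sum_(G : graph n | (#|G| == m) &&
     (eps * conditional_mean m < `|(num_matchings l G)%:R - conditional_mean m|))
    gnp_pmf p G
  <= (expR (2 * l%:R ^+ 3 / (m%:R * (m%:R - 2 * l%:R))) - 1) / eps ^+ 2
     * binomial_pmf N p m.
Proof.
move=> eps0 lm mN; set c := conditional_mean m; set K := expR _.
have c0 : 0 < c.
  by rewrite mulr_gt0 ?ltr0n ?card_matchings_gt0// falling_ratio_gt0//; lia.
have var : \sum_(G : graph n | #|G| == m) ((num_matchings l G)%:R - c) ^+ 2
    <= 'C(N, m)%:R * (c ^+ 2 * (K - 1)).
  have -> : \sum_(G : graph n | #|G| == m) ((num_matchings l G)%:R - c) ^+ 2
     = \sum_(G : graph n | #|G| == m) (members_in (matchings n l) G)%:R ^+ 2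
       - 2 * c * (\sum_(G : graph n | #|G| == m) (members_in (matchings n l) G)%:R)
       + c ^+ 2 * (\sum_(G : graph n | #|G| == m) 1).
    rewrite !mulr_sumr -sumrB -big_split/=; apply: eq_bigr => G _.
    by rewrite num_matchingsE; ring.
  rewrite (sum_members_in _ size_matchings) (sum_sqr_members_in _ size_matchings).
  have -> : \sum_(G : graph n | #|G| == m) 1 = 'C(N, m)%:R :> R.
    rewrite sumr_const /N -card_edges -card_draws; congr (_%:R).
    by apply: eq_card => G; rewrite !inE.
  rewrite card_edges -/N -/(conditional_mean m) -/c.
  have := sum_falling_ratio_overlap_le R ln lm mN.
  rewrite -/N -/(conditional_mean m) -/c -/K.
  move/(ler_wpM2l (ler0n R 'C(N, m))); lra.
set w := p ^+ m * (1 - p) ^+ (N - m).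
have w0 : 0 <= w.
  by case/andP: p01 => *; rewrite mulr_ge0 ?exprn_ge0 ?subr_ge0.
have e2 : 0 < (eps * c) ^+ 2 by apply: exprn_gt0; exact: mulr_gt0.
rewrite (eq_bigr (fun=> w)) => [|G /andP[/eqP Gm _]]; last by rewrite gnp_pmfE /w Gm.
apply: le_trans (_ : w / (eps * c) ^+ 2 *
   \sum_(G : graph n | #|G| == m) ((num_matchings l G)%:R - c) ^+ 2 <= _).
  rewrite mulr_sumr big_mkcondr/=; apply: ler_sum => G _.
  case: ifPn => [H|_]; last first.
    by apply: mulr_ge0; [apply: divr_ge0 => //; exact: ltW|exact: sqr_ge0].
  rewrite -[leLHS]mulr1 -mulrA ler_wpM2l// mulrC ler_pdivlMr// mul1r.
  rewrite -[leRHS]real_normK ?num_real// lerXn2r ?nnegrE//; last exact: ltW.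
  by apply: ltW; exact: mulr_gt0.
apply: le_trans (ler_wpM2l _ var) _; first by apply: divr_ge0 => //; exact: ltW.
rewrite /binomial_pmf -/N -/w -[w *+ _]mulr_natl.
rewrite le_eqVlt; apply/orP; left; apply/eqP; field.
by rewrite !gt_eqF.
Qed.

Lemma concentration (A eps delta : R) : 0 < A -> 0 < eps -> 0 <= delta ->
  (forall m, (m%:R - p * N%:R) ^+ 2 <= A ^+ 2 * (N%:R * p * (1 - p)) -> (m <= N)%N ->
     (2 * l < m)%N /\ 2 * l%:R ^+ 3 / (m%:R * (m%:R - 2 * l%:R)) <= delta) ->
  \sum_(G : graph n | (A ^+ 2 * (N%:R * p * (1 - p)) < (#|G|%:R - p * N%:R) ^+ 2)
     || (eps * conditional_mean #|G|
          < `|(num_matchings l G)%:R - conditional_mean #|G| |)) gnp_pmf p G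
  <= A ^- 2 + (expR delta - 1) / eps ^+ 2.
Proof.
move=> A0 eps0 d0 Hm.
have w0 G : 0 <= gnp_pmf p G by exact: gnp_pmf_ge0.
have GN G : (#|G| <= N)%N by rewrite /N -card_edges max_card.
set far := fun G : graph n => A ^+ 2 * (N%:R * p * (1 - p)) < (#|G|%:R - p * N%:R) ^+ 2.
set dev := fun m (G : graph n) => eps * conditional_mean m
   < `|(num_matchings l G)%:R - conditional_mean m|.
apply: le_trans (_ : \sum_(G : graph n | far G) gnp_pmf p G
   + \sum_(G : graph n | ~~ far G && dev #|G| G) gnp_pmf p G <= _).
  rewrite big_mkcond [X in _ <= X + _]big_mkcond [X in _ <= _ + X]big_mkcond/=.
  rewrite -big_split/=; apply: ler_sum => G _; rewrite -/(far G) -/(dev #|G| G).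
  by case: (far G); case: (dev _ G); rewrite /= ?addr0 ?add0r.
apply: lerD; first exact: gnp_card_chebyshev.
rewrite (partition_big (fun G => inord #|G| : 'I_N.+1) xpredT)//=.
(* The constant on the right is multiplied by the total mass 1, which is split by edge count like
   the left side; the comparison is then made for each m. *)
rewrite -[leRHS]mulr1 -[X in _ <= _ * X](gnp_pmf_sum1 n p).
rewrite [X in _ <= _ * X](partition_big (fun G => inord #|G| : 'I_N.+1) xpredT)//=.
rewrite mulr_sumr; apply: ler_sum => m _.
have mN : (m <= N)%N by rewrite -ltnS ltn_ord.
have inordE G : ((inord #|G| : 'I_N.+1) == m) = (#|G| == m).
  by rewrite -val_eqE/= inordK// ltnS.
rewrite (eq_bigl _ _ inordE) sum_gnp_pmf_eqcard -/N.
(* An edge count outside the Chebyshev window contributes nothing, since its graphs are all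
   [far]. *)
have [H|H] := leP ((m%:R - p * N%:R) ^+ 2) (A ^+ 2 * (N%:R * p * (1 - p))); last first.
  rewrite big_pred0 => [|G]; last first.
    rewrite inordE; apply/negP => /andP[/andP[/negP nf _] /eqP Gm].
    by apply: nf; rewrite /far Gm.
  apply: mulr_ge0; last exact: binomial_pmf_ge0.
  apply: divr_ge0; last exact/exprn_ge0/ltW.
  by have := expR_ge1Dx delta; lra.
have [lm dm] := Hm m H mN.
apply: le_trans (_ : \sum_(G : graph n | (#|G| == m) && dev m G) gnp_pmf p G <= _).
  rewrite big_mkcond [leRHS]big_mkcond/=; apply: ler_sum => G _; rewrite inordE.
  have [->|] := eqVneq #|G| m; last by rewrite andbF.
  by rewrite andbT/=; case: (dev m G); rewrite ?andbF// andbT; case: (far G).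
apply: le_trans (deviation_given_size eps0 lm mN) _.
rewrite ler_wpM2r ?binomial_pmf_ge0// ler_wpM2r ?invr_ge0 ?sqr_ge0//.
by rewrite lerB// ler_expR.
Qed.

End concentration.

(** * Asymptotic normality of the number of edges *)

Section normal_cdf.
Local Open Scope classical_set_scope.
Variable R : realType.
Implicit Types x y : R.

Local Notation mu := (@lebesgue_measure R).
Local Notation normal := (@normal_prob R 0 1).

Definition Phi x : R := fine (normal `]-oo, x]).

Lemma PhiE x : normal `]-oo, x] = (Phi x)%:E.
Proof. by rewrite /Phi fineK// fin_num_measure. Qed.

Lemma normal_prob_itv x y : x <= y -> normal `]x, y] = (Phi y - Phi x)%:E.
Proof.
move=> xy.
have m1 : measurable (`]-oo, x] : set R) by [].
have m2 : measurable (`]x, y] : set R) by [].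
have : (normal `]-oo, y] = normal `]-oo, x] + normal `]x, y])%E.
  rewrite -measureU// -?itv_bndbnd_setU ?bnd_simp//.
  apply/seteqP; split => z //=; rewrite !in_itv/= => -[zx /andP[xz _]].
  by rewrite ltNge zx in xz.
by rewrite !PhiE EFinB => ->; rewrite [X in (X - _)%E]addeC addeK.
Qed.

Lemma normal_pdf01E x : normal_pdf 0 1 x = normal_peak 1 * expR (- x ^+ 2 / 2).
Proof.
by rewrite normal_pdfE ?oner_neq0// /normal_fun subr0 expr1n.
Qed.

Lemma Phi_increment x y (m M : R) : x <= y -> 0 <= m ->
  (forall z, x <= z <= y -> m <= normal_pdf 0 1 z <= M) ->
  m * (y - x) <= Phi y - Phi x <= M * (y - x).
Proof.
move=> xy m0 H.
have M0 : 0 <= M.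
  have /H/andP[h1 h2] : x <= x <= y by rewrite lexx.
  exact: le_trans m0 (le_trans h1 h2).
have muE : mu `]x, y] = (y - x)%:E.
  rewrite lebesgue_measure_itv/= lte_fin; case: ltP => // yx.
  have -> : x = y by apply/eqP; rewrite eq_le xy.
  by rewrite subrr.
rewrite -!lee_fin -normal_prob_itv// !EFinM -muE -!integral_cst//.
apply/andP; split; apply: ge0_le_integral => //.
- by apply/measurable_EFinP/measurable_funTS; exact: measurable_normal_pdf.
- move=> z /=; rewrite in_itv/= => /andP[/ltW xz zy].
  have /H/andP[h1 h2] : x <= z <= y by rewrite xz.
  by rewrite lee_fin.
- by move=> z _; rewrite lee_fin normal_pdf_ge0.
- by apply/measurable_EFinP/measurable_funTS; exact: measurable_normal_pdf.
- move=> z /=; rewrite in_itv/= => /andP[/ltW xz zy].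
  have /H/andP[h1 h2] : x <= z <= y by rewrite xz.
  by rewrite lee_fin.
Qed.

Lemma Phi_nondecreasing x y : x <= y -> Phi x <= Phi y.
Proof.
move=> xy; rewrite -lee_fin -!PhiE le_measure ?inE//.
by apply: subset_itvl; rewrite bnd_simp.
Qed.

Lemma Phi_ge0 x : 0 <= Phi x.
Proof. by rewrite -lee_fin -PhiE. Qed.

Lemma Phi_le1 x : Phi x <= 1.
Proof. by rewrite -lee_fin -PhiE probability_le1. Qed.

Lemma Phi_lipschitz x y : x <= y -> Phi y - Phi x <= normal_peak 1 * (y - x).
Proof.
move=> xy; have [] := andP (@Phi_increment x y 0 (normal_peak 1) xy (lexx 0) _) => // z _.
by rewrite normal_pdf_ge0 normal_pdf_ub ?oner_neq0.
Qed.

(** Between x and x + h the square of the argument changes by at most h (2A + 1), hence the exponent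
    of the density by at most (A + 1) h. *)
Lemma Phi_increment_pdf (A h x : R) : 0 <= h <= 1 -> `|x| <= A ->
  normal_peak 1 * h * expR (- x ^+ 2 / 2) * expR (- ((A + 1) * h))
    <= Phi (x + h) - Phi x
    <= normal_peak 1 * h * expR (- x ^+ 2 / 2) * expR ((A + 1) * h).
Proof.
move=> /andP[h0 h1] /ler_normlP[xA1 xA2].
have xh : x <= x + h by rewrite lerDl.
pose m s := normal_peak 1 * expR (- x ^+ 2 / 2 + s).
have c0 : 0 <= normal_peak 1 :> R by exact: normal_peak_ge0.
have H z : x <= z <= x + h -> m (- ((A + 1) * h)) <= normal_pdf 0 1 z <= m ((A + 1) * h).
  move=> /andP[xz zh]; rewrite normal_pdf01E /m.
  have b1 : (z - x) * (z + x) <= 2 * ((A + 1) * h) by nra.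
  have b2 : - (2 * ((A + 1) * h)) <= (z - x) * (z + x) by nra.
  apply/andP; split; rewrite ler_wpM2l// ler_expR; lra.
have := Phi_increment xh (mulr_ge0 c0 (expR_ge0 _)) H.
have -> : x + h - x = h by ring.
by rewrite /m !expRD !mulrA ![normal_peak 1 * _ * _ * h]mulrAC ![normal_peak 1 * _ * h]mulrAC.
Qed.

(** The identity as a random variable under the normal law: its distribution function is [Phi], so
    the general limits of distribution functions at infinity apply. *)
Let idTR : measurableTypeR R -> R := idfun.

#[local] HB.instance Definition _ :=
  @isMeasurableFun.Build _ _ _ _ idTR (@measurable_id _ _ setT).

Lemma Phi_tails (e : R) : 0 < e ->
  \forall A \near +oo, Phi (- A) <= e /\ 1 - e <= Phi A.
Proof.
move=> e0; near=> A; split.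
  near: A.
  have : Phi x @[x --> -oo] --> 0.
    by apply: fine_cvg; exact: (@cvg_cdfNy0 _ _ _ _ (idTR : {RV normal >-> R})).
  by rewrite cvgNy_compNP => /cvgr_le; exact.
near: A.
have /cvgr_ge : Phi x @[x --> +oo] --> (1 : R).
  by apply: fine_cvg; exact: (@cvg_cdfy1 _ _ _ _ (idTR : {RV normal >-> R})).
by apply; rewrite ltrBlDr ltrDl.
Unshelve. all: by end_near. Qed.

End normal_cdf.

(** * Ratios of binomial weights against the Gaussian density *)

Section binomial_local_ratio.
Variable R : realType.

(** From 1 / (1 + u) = 1 - u / (1 + u) <= exp (- u / (1 + u)), together with u - 2 u^2 <= u / (1 +
    u), which amounts to u^2 (1 + 2u) >= 0. *)
Lemma expR_sub_sqr_le (u : R) : `|u| <= 1 / 2 -> expR (u - 2 * u ^+ 2) <= 1 + u.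
Proof.
move=> /ler_normlP[u1 u2].
have u0 : 0 < 1 + u by lra.
rewrite -[leLHS]invrK -expRN -[leRHS]invrK lef_pV2 ?posrE ?invr_gt0 ?expR_gt0//.
apply: le_trans (_ : expR (- (u / (1 + u))) <= _).
  apply: le_trans (expR_ge1Dx _); rewrite le_eqVlt; apply/orP; left; apply/eqP.
  by field; rewrite gt_eqF.
rewrite ler_expR lerNl opprK ler_pdivlMr//.
have : 0 <= u ^+ 2 * (1 + 2 * u) by rewrite mulr_ge0 ?sqr_ge0//; lra.
lra.
Qed.

Lemma expR_le1D2x (y : R) : 0 <= y <= 1 / 2 -> expR y <= 1 + 2 * y.
Proof.
move=> /andP[y0 y1].
have H := expR_ge1Dx (- y).
have H1 : expR y * expR (- y) = 1 by rewrite -expRD subrr expR0.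
have := expR_gt0 y; nra.
Qed.

Lemma binomial_pmfS N (p : R) k :
  binomial_pmf N p k.+1 * (k.+1%:R * (1 - p))
  = binomial_pmf N p k * ((N - k)%N%:R * p).
Proof.
have bE i : binomial_pmf N p i = 'C(N, i)%:R * (p ^+ i * (1 - p) ^+ (N - i)).
  by rewrite mulr_natl.
rewrite !bE.
have [Nk|kN] := leqP N k.
  by rewrite bin_small ?ltnS// (eqP (_ : N - k == 0)%N) ?subn_eq0//; ring.
have E := mul_bin_left N k.
have E' : k.+1%:R * 'C(N, k.+1)%:R = (N - k)%N%:R * 'C(N, k)%:R :> R.
  by rewrite -!natrM E.
have -> : (N - k = (N - k.+1).+1)%N by rewrite subnSK.
rewrite -subnSK// in E'.
rewrite exprS [in RHS]exprS.
transitivity (k.+1%:R * 'C(N, k.+1)%:R * (p * p ^+ k * (1 - p) ^+ (N - k.+1) * (1 - p))).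
  by ring.
by rewrite E'; ring.
Qed.

Variables (N : nat) (p A : R).
Hypothesis p01 : 0 < p < 1.

Let v := N%:R * p * (1 - p).
Let s := Num.sqrt v.
Let h := s^-1.
Definition standardized k : R := (k%:R - p * N%:R) / Num.sqrt (N%:R * p * (1 - p)).
Local Notation x := standardized.
Local Notation b := (binomial_pmf N p).

(** The binomial weight divided by its Gaussian shape. It is nearly constant on the window
    [|x k| <= A], and the constant never has to be known. *)
Let D k := b k * expR (x k ^+ 2 / 2).

Hypothesis A1 : 1 <= A.
Hypothesis v0 : 0 < v.
Hypothesis hA : (A + 1) * h <= 1 / 2.

Let p0 : 0 < p. Proof. by case/andP: p01. Qed.
Let q0 : 0 < 1 - p. Proof. by case/andP: p01 => *; rewrite subr_gt0. Qed.
Let s0 : 0 < s. Proof. by rewrite sqrtr_gt0. Qed.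
Let h0 : 0 < h. Proof. by rewrite invr_gt0. Qed.
Let hs : h * s = 1. Proof. by rewrite mulVf// gt_eqF. Qed.
Let s2 : s ^+ 2 = v. Proof. by rewrite sqr_sqrtr// ltW. Qed.
Let K := 3 * (A + 1) ^+ 2.

Lemma standardizedS k : x k.+1 = x k + h.
Proof. by rewrite /standardized -/v -/s -natr1 /h; field; rewrite gt_eqF. Qed.

Lemma standardizedD k d : x (k + d) = x k + d%:R * h.
Proof. by rewrite /standardized -/v -/s natrD /h; field; rewrite gt_eqF. Qed.

Lemma standardizedE k : k%:R = p * N%:R + x k * s.
Proof. by rewrite /standardized -/v -/s divfK ?gt_eqF//; ring. Qed.

Let b_ge0 k : 0 <= b k.
Proof. by apply: binomial_pmf_ge0; case/andP: p01 => *; rewrite !ltW. Qed.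

(** The ratio of consecutive weights is (1 + u1) / (1 + u2) and the Gaussian shape contributes exp
    (X h + h^2 / 2). The first-order terms cancel up to (1 - p) h^2. Of the 3 in [K], two come from
    the quadratic loss in [expR_sub_sqr_le] and one from the remaining multiples of h^2. *)
Let step k : `|x k| <= A ->
  D k.+1 <= D k * expR (K * h ^+ 2) /\ D k <= D k.+1 * expR (K * h ^+ 2).
Proof.
move=> /ler_normlP[X1 X2]; set X := x k in X1 X2.
have [[[h0' p0'] A1'] hA'] := (h0, p0, A1, hA).
have [h1 q1] : h <= 1 / 2 /\ 1 - p <= 1 by split; nra.
(* These are the relative deviations from [v] of the two sides of the recursion [binomial_pmfS]: (N
   - k) p = v (1 + u1) and (k + 1)(1 - p) = v (1 + u2). *)
pose u1 := - (X * p * h); pose u2 := X * (1 - p) * h + (1 - p) * h ^+ 2.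
have Xh : `|X * h| <= A * h.
  by rewrite normrM (ger0_norm (ltW h0)) (ler_wpM2r (ltW h0))//; apply/ler_normlP.
have /ler_normlP[Xh1 Xh2] := Xh.
have h20 : 0 <= h ^+ 2 by exact: sqr_ge0.
have Ah0 : 0 <= A * h by apply: mulr_ge0; lra.
have hh : h ^+ 2 <= h by nra.
have u1b : `|u1| <= A * h.
  rewrite /u1 normrN mulrAC normrM (ger0_norm (ltW p0)).
  by apply: le_trans Xh; rewrite ler_piMr//; have := q0; lra.
have u2b : `|u2| <= (A + 1) * h.
  have -> : u2 = (X * h + h ^+ 2) * (1 - p) by rewrite /u2; ring.
  rewrite normrM (ger0_norm (ltW q0)).
  apply: le_trans (_ : `|X * h + h ^+ 2| <= _); first by rewrite ler_piMr.
  by apply/ler_normlP; split; lra.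
have sq (u B : R) : `|u| <= B -> u ^+ 2 <= B ^+ 2.
  by move=> uB; rewrite -real_normK ?num_real// lerXn2r ?nnegrE ?normr_ge0// (le_trans _ uB).
have u1s := sq _ _ u1b; have u2s := sq _ _ u2b.
have u1h : `|u1| <= 1 / 2 by apply: le_trans u1b _; lra.
have u2h : `|u2| <= 1 / 2 by apply: le_trans u2b _.
have NkE : (N%:R - k%:R) * p = v * (1 + u1).
  rewrite /u1 (standardizedE k) -/X.
  have -> : v * (1 + - (X * p * h)) = v - X * p * s * (h * s) by rewrite -s2; ring.
  by rewrite hs /v; ring.
have kN : (k <= N)%N.
  rewrite -(ler_nat R) -subr_ge0 -(pmulr_lge0 _ p0) NkE mulr_ge0 ?(ltW v0)//.
  by case/ler_normlP: u1h; lra.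
have kqE : k.+1%:R * (1 - p) = v * (1 + u2).
  rewrite /u2 -natr1 (standardizedE k) -/X.
  have -> : v * (1 + (X * (1 - p) * h + (1 - p) * h ^+ 2))
    = v + X * (1 - p) * s * (h * s) + (1 - p) * (h * s) ^+ 2 by rewrite -s2; ring.
  by rewrite hs /v; ring.
have rec : b k.+1 * (1 + u2) = b k * (1 + u1).
  apply: (mulfI (lt0r_neq0 v0)).
  rewrite mulrCA -kqE binomial_pmfS natrB// NkE; ring.
have Drec : D k.+1 * (1 + u2) = D k * ((1 + u1) * expR (X * h + h ^+ 2 / 2)).
  rewrite /D standardizedS -/X.
  have -> : (X + h) ^+ 2 / 2 = X ^+ 2 / 2 + (X * h + h ^+ 2 / 2) by field.
  rewrite expRD; have := rec; move: (expR _) (expR _) => e1 e2 {}rec.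
  by rewrite mulrAC rec; ring.
have D0 j : 0 <= D j by rewrite mulr_ge0 ?expR_ge0.
have e1 := expR_sub_sqr_le u1h; have e2 := expR_sub_sqr_le u2h.
have f1 := expR_ge1Dx u1; have f2 := expR_ge1Dx u2.
have A0 : 0 <= A by lra.
have W1 : h ^+ 2 <= (A + 1) ^+ 2 * h ^+ 2 by rewrite ler_peMl//; nra.
have W2 : ((A + 1) * h) ^+ 2 = (A + 1) ^+ 2 * h ^+ 2 by rewrite exprMn.
have W3 : (A * h) ^+ 2 <= (A + 1) ^+ 2 * h ^+ 2.
  by rewrite exprMn ler_wpM2r//; nra.
have W4 : 0 <= (1 - p) * h ^+ 2 by rewrite mulr_ge0// ltW.
have W5 : (1 - p) * h ^+ 2 <= h ^+ 2 by rewrite ler_piMl.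
have KE : K * h ^+ 2 = 3 * ((A + 1) ^+ 2 * h ^+ 2) by rewrite /K mulrA.
have uE : u1 - u2 + X * h = - ((1 - p) * h ^+ 2) by rewrite /u1 /u2; ring.
rewrite KE; move: W1 W2 W3 W4 W5 uE u1s u2s.
set W := (A + 1) ^+ 2 * h ^+ 2; set Z := (1 - p) * h ^+ 2.
move=> W1 W2 W3 W4 W5 uE u1s u2s.
split.
- rewrite -(ler_pM2r (expR_gt0 (u2 - 2 * u2 ^+ 2))).
  apply: le_trans (ler_wpM2l (D0 k.+1) e2) _; rewrite Drec.
  rewrite -[leRHS]mulrA ler_wpM2l// -expRD.
  apply: le_trans (ler_wpM2r (expR_ge0 _) f1) _; rewrite -expRD ler_expR.
  lra.
- rewrite -(ler_pM2r (expR_gt0 (u1 - 2 * u1 ^+ 2 + (X * h + h ^+ 2 / 2)))).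
  apply: le_trans (_ : D k * ((1 + u1) * expR (X * h + h ^+ 2 / 2)) <= _).
    by rewrite expRD ler_wpM2l// ler_wpM2r ?expR_ge0.
  rewrite -Drec -[leRHS]mulrA ler_wpM2l// -expRD.
  apply: le_trans f2 _; rewrite ler_expR.
  lra.
Qed.

Let chain k d : - A <= x k -> x (k + d) <= A ->
  D (k + d) <= D k * expR (K * h ^+ 2 * d%:R) /\
  D k <= D (k + d) * expR (K * h ^+ 2 * d%:R).
Proof.
move=> xk; elim: d => [|d IH].
  by rewrite addn0 mulr0 expR0 mulr1.
rewrite addnS standardizedS => xd.
have [|IH1 IH2] := IH; first by have := h0; lra.
have /step[S1 S2] : `|x (k + d)| <= A.
  apply/ler_normlP; split; last by have := h0; lra.
  by rewrite standardizedD; have := mulr_ge0 (ler0n R d) (ltW h0); lra.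
have E : expR (K * h ^+ 2 * d.+1%:R) = expR (K * h ^+ 2 * d%:R) * expR (K * h ^+ 2).
  by rewrite -expRD -natr1; congr expR; ring.
rewrite E; split.
  by rewrite mulrA; apply: le_trans S1 _; rewrite ler_wpM2r ?expR_ge0.
apply: le_trans IH2 _.
by rewrite [expR _ * expR _]mulrC [leRHS]mulrA ler_wpM2r ?expR_ge0.
Qed.

(** Two points of the window are at most 2A / h steps apart, and each step costs K h^2 in the
    exponent. *)
Let D_le j k : `|x j| <= A -> `|x k| <= A -> D k <= D j * expR (2 * A * K * h).
Proof.
move=> /ler_normlP[j1 j2] /ler_normlP[k1 k2].
have K0 : 0 <= K by rewrite /K mulr_ge0 ?sqr_ge0.
have D0 i : 0 <= D i by rewrite mulr_ge0 ?expR_ge0.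
have bound d : d%:R * h <= 2 * A -> expR (K * h ^+ 2 * d%:R) <= expR (2 * A * K * h).
  move=> dA; rewrite ler_expR.
  have := mulr_ge0 K0 (ltW h0) => /(ler_wpM2l)/(_ _ _ dA); lra.
have [jk|kj] := leqP j k.
  have E := standardizedD j (k - j); rewrite subnKC// in E.
  have [||H _] := @chain j (k - j); rewrite ?subnKC//; first by lra.
  rewrite subnKC// in H.
  by apply: le_trans H _; rewrite ler_wpM2l// bound//; lra.
have kj' := ltnW kj.
have E := standardizedD k (j - k); rewrite subnKC// in E.
have [||_ H] := @chain k (j - k); rewrite ?subnKC//; first by lra.
rewrite subnKC// in H.
by apply: le_trans H _; rewrite ler_wpM2l// bound//; lra.
Qed.

(* The unknown normalising constant of the local approximation cancels in the
   products b k * dPhi j, which avoids Stirling's formula. *)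
Lemma binomial_Phi_cross j k : `|x j| <= A -> `|x k| <= A ->
  b k * (Phi (x j.+1) - Phi (x j))
  <= expR ((6 * A * (A + 1) ^+ 2 + 2 * (A + 1)) * h) * (b j * (Phi (x k.+1) - Phi (x k))).
Proof.
move=> xj xk.
have [[h0' A1'] hA'] := (h0, A1, hA).
have hh : 0 <= h <= 1 by apply/andP; split; [exact: ltW|nra].
have /andP[_ Pj] := Phi_increment_pdf hh xj.
have /andP[Pk _] := Phi_increment_pdf hh xk.
rewrite !standardizedS.
have c0 : 0 <= normal_peak 1 :> R by exact: normal_peak_ge0.
set g := fun i => expR (- x i ^+ 2 / 2) in Pj Pk *.
set c := normal_peak 1 in c0 Pj Pk *.
have DE i : b i = D i * g i.
  by rewrite /D /g -mulrA -expRD mulNr subrr expR0 mulr1.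
apply: le_trans (ler_wpM2l (b_ge0 k) Pj) _.
set E := expR ((6 * _ * _ + _) * h).
apply: le_trans (_ : E * (b j * (c * h * g k * expR (- ((A + 1) * h)))) <= _); last first.
  by rewrite ler_wpM2l ?expR_ge0// ler_wpM2l.
rewrite (DE k) (DE j).
(* The term 6 A (A + 1)^2 is 2 A K, the cost of moving [D] from j to k; the two other factors come
   from replacing the increments of [Phi] at j and at k by the density. *)
have EE : E = expR (2 * A * K * h) * expR ((A + 1) * h) * expR ((A + 1) * h).
  by rewrite -!expRD; congr expR; rewrite /K; ring.
have e1 : expR ((A + 1) * h) * expR (- ((A + 1) * h)) = 1 by rewrite -expRD subrr expR0.
apply: le_trans (_ : D j * expR (2 * A * K * h) * g k
  * (c * h * g j * expR ((A + 1) * h)) <= _).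
  apply: ler_wpM2r.
    by apply: mulr_ge0 (expR_ge0 _); apply: mulr_ge0 (expR_ge0 _); exact: mulr_ge0 (ltW h0).
  by apply: ler_wpM2r (expR_ge0 _) _ _ _; exact: D_le.
rewrite EE; set e := expR ((A + 1) * h) in e1 *.
rewrite le_eqVlt; apply/orP; left; apply/eqP.
set e' := expR (- ((A + 1) * h)) in e1 *.
by rewrite -[LHS]mulr1 -[X in _ * X]e1; ring.
Qed.

End binomial_local_ratio.

(** * Central limit theorem for the edge count *)

Section edge_count_clt.
Variable R : realType.

Lemma sum_binomial_pmf n (p : R) a b :
  \sum_(a <= k < b) binomial_pmf 'C(n, 2) p k
  = \sum_(G : graph n | (a <= #|G| < b)%N) gnp_pmf p G.
Proof.
transitivity (\sum_(a <= k < b) \sum_(G : graph n | #|G| == k) gnp_pmf p G).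
  by apply: eq_bigr => k _; rewrite sum_gnp_pmf_eqcard.
under eq_bigr do rewrite big_mkcond/=.
rewrite exchange_big/= [RHS]big_mkcond/=; apply: eq_bigr => G _.
rewrite -big_mkcond/=; under eq_bigl do rewrite eq_sym.
by rewrite big_nat1_eq.
Qed.

Lemma sum_Phi_increments n (p : R) a b : (a <= b)%N ->
  \sum_(a <= k < b) (Phi (standardized n p k.+1) - Phi (standardized n p k))
  = Phi (standardized n p b) - Phi (standardized n p a).
Proof. by move=> ab; rewrite (telescope_sumr (fun k => Phi (standardized n p k))). Qed.

Lemma Phi_right (y z h eta : R) : y < z <= y + h -> normal_peak 1 * h <= eta ->
  Phi y <= Phi z <= Phi y + eta.
Proof.
move=> /andP[yz zh] heta; rewrite (Phi_nondecreasing (ltW yz))/=.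
rewrite -lerBlDl; apply: le_trans (Phi_lipschitz (ltW yz)) _.
apply: le_trans heta; rewrite ler_wpM2l ?normal_peak_ge0//.
by rewrite lerBlDl.
Qed.

(** [M] and [MA] stand for the binomial masses of the windows from -A to t and from -A to A, [S] and
    [SA] for the normal ones. The cross inequalities say that M / MA and S / SA nearly agree; as
    [MA] and [SA] are close to 1, the normalising constant drops out. *)
Lemma cross_ratio_estimate (F M S MA SA E eta : R) : 0 < eta <= 1 / 8 ->
  0 <= F <= 1 -> 0 <= M -> 0 <= S -> 0 <= E <= 1 + eta ->
  1 - eta <= MA <= 1 -> 1 - 3 * eta <= SA <= 1 ->
  F - 2 * eta <= S <= F + eta ->
  M * SA <= E * (MA * S) -> MA * S <= E * (M * SA) ->
  F - 10 * eta <= M <= F + 9 * eta.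
Proof.
move=> /andP[eta0 eta1] /andP[F0 F1] M0 S0 /andP[E0 E1] /andP[MA1 MA2].
move=> /andP[SA1 SA2] /andP[S1 S2] c1 c2.
have up : M * (1 - 3 * eta) <= (1 + eta) * (F + eta).
  apply: le_trans (_ : M * SA <= _); first by rewrite ler_wpM2l.
  apply: le_trans c1 _; apply: ler_pM => //.
    by apply: mulr_ge0 => //; apply: le_trans MA1; rewrite subr_ge0; lra.
  by apply: le_trans S2; rewrite ler_piMl.
have low : (1 - eta) * S <= (1 + eta) * M.
  apply: le_trans (_ : MA * S <= _); first by rewrite ler_wpM2r.
  apply: le_trans c2 _; apply: ler_pM => //.
    by apply: mulr_ge0 => //; apply: le_trans SA1; rewrite subr_ge0; lra.
  by rewrite ler_piMr.
clear c1 c2 E0 E1 SA1 SA2 MA1 MA2.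
have k1 : 0 <= eta * (1 - F) by apply: mulr_ge0; lra.
have k2 : 0 <= eta * (1 / 8 - eta) by apply: mulr_ge0; lra.
have k3 : 0 <= (1 - eta) * (S - (F - 2 * eta)) by apply: mulr_ge0; lra.
have k4 : 0 <= M * (1 / 8 - eta) by apply: mulr_ge0; lra.
have M1 : 0 <= 9 / 4 - M by lra.
have k5 := mulr_ge0 (ltW eta0) M1; have k6 := sqr_ge0 eta.
by apply/andP; split; lra.
Qed.

Lemma edge_count_clt_window (n : nat) (p A t eta : R) :
  0 < p < 1 -> 0 < eta <= 1 / 8 -> 1 <= A -> - A <= t <= A ->
  (A / 2) ^- 2 <= eta -> Phi (- A) <= eta -> 1 - eta <= Phi A ->
  let v := 'C(n, 2)%:R * p * (1 - p) in
  let h := (Num.sqrt v)^-1 in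
  let kappa := 6 * A * (A + 1) ^+ 2 + 2 * (A + 1) in
  0 < v -> 2 * kappa * h <= eta -> normal_peak 1 * h <= eta ->
  `|\sum_(G : graph n | standardized 'C(n, 2) p #|G| <= t) gnp_pmf p G - Phi t|
  <= 10 * eta.
Proof.
move=> p01 /andP[eta0 eta1] A1 /andP[At tA] chA PhiN PhiA v h kappa v0 kh ch.
have /andP[p0 p1] := p01.
have p01' : 0 <= p <= 1 by rewrite !ltW.
set N := 'C(n, 2); set s := Num.sqrt v.
have s0 : 0 < s by rewrite sqrtr_gt0.
have h0 : 0 < h by rewrite invr_gt0.
have s2 : s ^+ 2 = v by rewrite sqr_sqrtr// ltW.
have hs : h * s = 1 by rewrite mulVf// gt_eqF.
have kA : 4 * (A + 1) <= 2 * kappa by rewrite /kappa; nra.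
have hA : (A + 1) * h <= 1 / 2.
  have := ler_wpM2r (ltW h0) kA; nra.
(* This makes p N + y s nonnegative for y >= -A, so that [truncn] below is a genuine integer part
   and not the default 0. *)
have As : A * s <= p * N%:R.
  have h1 : A * h <= 1 by nra.
  have : A * s <= v.
    rewrite -s2 expr2 -[leLHS]mul1r -hs.
    have -> : h * s * (A * s) = A * h * (s * s) by ring.
    by rewrite ler_piMl// mulr_ge0// ltW.
  move/le_trans; apply; rewrite /v mulrC -/N [p * _]mulrC ler_piMl//.
    by rewrite mulr_ge0// ltW.
  by lra.
pose x := @standardized R N p.
have xE k : k%:R = p * N%:R + x k * s by exact: standardizedE.
have xle k y : (x k <= y) = (k%:R <= p * N%:R + y * s).
  by rewrite (xE k) lerD2l ler_pM2r.
(* [e y] is the first index whose standardized value exceeds y. *)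
pose e y := (Num.truncn (p * N%:R + y * s)).+1.
have eP k y : - A <= y -> (k < e y)%N = (x k <= y).
  move=> Ay; rewrite xle ltnS truncn_ge_nat//.
  by have := ler_wpM2r (ltW s0) Ay; lra.
pose a := e (- A).
have eA y : - A <= y -> (a <= e y)%N.
  by move=> Ay; rewrite ltnS le_truncn// lerD2l ler_wpM2r// ltW.
have xS k : x k.+1 = x k + h by exact: standardizedS.
have xe y : - A <= y -> y < x (e y) <= y + h.
  move=> Ay; apply/andP; split; first by rewrite ltNge -eP// ltnn.
  by rewrite xS lerD2r -eP.
have win k y : - A <= y -> y <= A -> (a <= k < e y)%N -> `|x k| <= A.
  move=> Ay yA /andP[ak]; rewrite eP// => ky.
  have := eP k (- A) (lexx _); rewrite -/a ltnNge ak/= => /esym/negbT; rewrite -ltNge => xk.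
  by apply/ler_normlP; split; lra.
pose M y := \sum_(a <= k < e y) binomial_pmf N p k.
pose S y := \sum_(a <= k < e y) (Phi (x k.+1) - Phi (x k)).
have SE y : - A <= y -> S y = Phi (x (e y)) - Phi (x a).
  by move=> Ay; rewrite /S sum_Phi_increments ?eA.
have AA : - A <= A by lra.
pose E := expR (kappa * h).
have E1 : E <= 1 + eta.
  apply: le_trans (expR_le1D2x _) _; last by lra.
  by apply/andP; split; [rewrite mulr_ge0// ?ltW// /kappa; nra|lra].
have cross y z : - A <= y <= A -> - A <= z <= A -> M y * S z <= E * (M z * S y).
  move=> /andP[Ay yA] /andP[Az zA].
  have -> : E * (M z * S y) = \sum_(a <= k < e y) \sum_(a <= j < e z)
      E * (binomial_pmf N p j * (Phi (x k.+1) - Phi (x k))).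
    rewrite mulrA mulr_sumr; apply: eq_bigr => k _.
    by rewrite mulr_sumr mulr_suml; apply: eq_bigr => j _; rewrite mulrA.
  rewrite mulr_suml; apply: ler_sum_nat => k hk.
  rewrite mulr_sumr; apply: ler_sum_nat => j hj.
  by apply: binomial_Phi_cross => //; [exact: win hj|exact: win hk].
have w0 G : 0 <= gnp_pmf p G by exact: gnp_pmf_ge0.
have tail : \sum_(G : graph n | (x #|G| <= - A) || (A < x #|G|)) gnp_pmf p G <= eta.
  (* Chebyshev's inequality is stated for strict deviations; using A / 2 leaves room for the
     endpoint x = -A. *)
  have A2 : 0 < A / 2 by lra.
  apply: le_trans chA; apply: le_trans (gnp_card_chebyshev n p01' A2).
  rewrite big_mkcond [leRHS]big_mkcond/=; apply: ler_sum => G _.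
  case: ifPn => [H|_]; last by case: ifP.
  rewrite ifT// -/N -/v -s2.
  have -> : #|G|%:R - p * N%:R = x #|G| * s by rewrite (xE #|G|); ring.
  rewrite [(x _ * s) ^+ 2]exprMn ltr_pM2r ?exprn_gt0//.
  by case/orP: H => H; nra.
have ME y : M y = \sum_(G : graph n | (a <= #|G| < e y)%N) gnp_pmf p G.
  by rewrite /M sum_binomial_pmf.
have inWin G y : - A <= y -> (a <= #|G| < e y)%N = (- A < x #|G| <= y).
  by move=> Ay; rewrite eP// leqNgt eP// ltNge.
have Mt : M t <= \sum_(G : graph n | x #|G| <= t) gnp_pmf p G <= M t + eta.
  apply/andP; split.
    rewrite ME big_mkcond [leRHS]big_mkcond/=; apply: ler_sum => G _.
    rewrite inWin//; case: (ltP (- A) (x #|G|)) => /= _; first by [].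
    by case: ifP.
  apply: le_trans (lerD (lexx (M t)) tail).
  rewrite ME big_mkcond [X in _ <= X + _]big_mkcond [X in _ <= _ + X]big_mkcond/=.
  rewrite -big_split/=; apply: ler_sum => G _.
  rewrite inWin//; case: (ltP (- A) (x #|G|)) => /= _.
    by case: ifP => _; case: ifP => _; rewrite ?addr0 ?add0r ?lerDl.
  by case: ifP; rewrite add0r.
have MA : 1 - eta <= M A <= 1.
  rewrite -(gnp_pmf_sum1 n p); apply/andP; split.
    rewrite lerBlDr; apply: le_trans (lerD (lexx (M A)) tail).
    rewrite ME [X in _ <= X + _]big_mkcond [X in _ <= _ + X]big_mkcond/=.
    rewrite -big_split/=; apply: ler_sum => G _.
    rewrite inWin//; case: (ltP (- A) (x #|G|)) => /= _; last by rewrite add0r.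
    by case: (leP (x #|G|) A); rewrite ?addr0 ?add0r.
  rewrite ME [leLHS]big_mkcond/=; apply: ler_sum => G _.
  by case: ifP.
have M0 : 0 <= M t by rewrite ME; exact: sumr_ge0.
have h2 y z : y < z <= y + h -> Phi y <= Phi z <= Phi y + eta.
  by move/Phi_right; apply.
have xa : Phi (x a) <= eta + eta.
  have /h2/andP[_ x2] := xe (- A) (lexx _).
  by apply: le_trans x2 _; rewrite lerD2r.
have St : Phi t - 2 * eta <= S t <= Phi t + eta.
  rewrite SE//; have /h2/andP[x1 x2] := xe t At; apply/andP; split.
    by rewrite mulr_natl mulr2n; exact: lerB.
  by apply: le_trans x2; rewrite gerBl Phi_ge0.
have SA : 1 - 3 * eta <= S A <= 1.
  rewrite SE//; have /h2/andP[x1 x2] := xe A AA; apply/andP; split.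
    have -> : 1 - 3 * eta = (1 - eta) - (eta + eta) by ring.
    by apply: lerB => //; exact: le_trans x1.
  by apply: le_trans (Phi_le1 (x (e A))); rewrite gerBl Phi_ge0.
have tin : - A <= t <= A by rewrite At.
have Ain : - A <= A <= A by rewrite AA lexx.
have c1 := cross t A tin Ain; have c2 := cross A t Ain tin.
have S0 : 0 <= S t.
  by rewrite SE// subr_ge0; apply: Phi_nondecreasing; rewrite xle -xE ler_nat eA.
have F01 : 0 <= Phi t <= 1 by rewrite Phi_ge0 Phi_le1.
have E01 : 0 <= E <= 1 + eta by rewrite expR_ge0.
have eta01 : 0 < eta <= 1 / 8 by rewrite eta0.
have /andP[lo up] := cross_ratio_estimate eta01 F01 M0 S0 E01 MA SA St c1 c2.
have /andP[Mt1 Mt2] := Mt.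
rewrite ler_distl; apply/andP; split; first exact: le_trans lo Mt1.
apply: le_trans Mt2 _; apply: le_trans (lerD up (lexx eta)) _.
by rewrite le_eqVlt; apply/orP; left; apply/eqP; ring.
Qed.

End edge_count_clt.

(** * The conditional mean and the logarithm of the number of matchings *)

Section conditional_mean_asymptotics.
Variable R : realType.

(** The factor of index i is 1 + u with u = (m - P - (1 - p) i) / (p (N - i)), and [w] sums these
    quantities with denominator P. The first term of [eta] pays for replacing p (N - i) by P, the
    second for the quadratic loss 2 u^2 in the logarithm. *)
Lemma falling_ratio_exp (N m l : nat) (p B : R) :
  0 < p < 1 -> (0 < N)%N -> (2 * l <= N)%N -> (l <= m)%N ->
  `|m%:R - p * N%:R| <= B -> 4 * (B + l%:R) <= p * N%:R ->
  let P := p * N%:R in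
  let eta := 2 * l%:R * (B + l%:R) / (P * N%:R) + 8 * (B + l%:R) ^+ 2 / P ^+ 2 in
  let w := fun k : nat =>
    ((m%:R - P) * k%:R - (1 - p) * (k%:R * (k%:R - 1) / 2)) / P in
  forall k, (k <= l)%N ->
  expR (w k - k%:R * eta) <= falling_ratio R N m k / p ^+ k <= expR (w k + k%:R * eta).
Proof.
move=> p01 N0 lN lm mB BP P eta w; have /andP[p0 p1] := p01.
have N0' : 0 < N%:R :> R by rewrite ltr0n.
have P0 : 0 < P by rewrite mulr_gt0.
set y := m%:R - P in mB w *.
have B0 : 0 <= B by exact: le_trans mB.
have l0 : 0 <= l%:R :> R by [].
set c := (B + l%:R) / P.
have c0 : 0 <= c by rewrite divr_ge0 ?addr_ge0// ltW.
have c1 : 4 * c <= 1 by rewrite /c mulrA ler_pdivrMr// mul1r.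
have etaE : eta = 2 * (l%:R / N%:R) * c + 8 * c ^+ 2.
  by rewrite /eta /c; field; rewrite !gt_eqF.
elim=> [_|k IH kl].
  rewrite /w !mul0r !mulr0 subrr mul0r subrr add0r expR0.
  by rewrite /falling_ratio !ffactn0 expr0 !divr1 lexx.
have {IH} := IH (ltnW kl).
move=> /andP[IH1 IH2].
pose d : R := N%:R - k%:R.
have kN : k%:R <= N%:R / 2 :> R.
  by rewrite ler_pdivlMr// -natrM ler_nat mulnC (leq_trans _ lN)// leq_mul2l ltnW.
have d0 : N%:R / 2 <= d by rewrite /d; lra.
have dp : 0 < d by lra.
pose z := y - (1 - p) * k%:R.
pose u := z / (p * d).
have kl' : k%:R <= l%:R :> R by rewrite ler_nat ltnW.
have k0 : 0 <= k%:R :> R by [].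
have zB : `|z| <= B + l%:R.
  apply: le_trans (ler_normB _ _) _; apply: lerD => //.
  by rewrite ger0_norm ?mulr_ge0//; nra.
have zc : `|z / P| <= c.
  by rewrite normrM [`|P^-1|]gtr0_norm ?invr_gt0// ler_wpM2r// invr_ge0 ltW.
have uz : u = z / P * (N%:R / d) by rewrite /u /P; field; rewrite !gt_eqF.
have Nd : 0 <= N%:R / d <= 2.
  by rewrite divr_ge0 ?ler_pdivrMr ?(ltW dp)//; lra.
have uc : `|u| <= 2 * c.
  rewrite uz normrM mulrC [`|N%:R / d|]ger0_norm; last by case/andP: Nd.
  by case/andP: Nd => ? ?; apply: ler_pM.
have uw : `|u - z / P| <= 2 * (l%:R / N%:R) * c.
  have -> : u - z / P = (k%:R / d) * (z / P).
    by rewrite /u /P /d; field; rewrite -/d !gt_eqF.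
  rewrite normrM; apply: ler_pM => //.
  rewrite ger0_norm ?divr_ge0 ?(ltW dp)//.
  rewrite ler_pdivrMr//.
  have -> : k%:R = 2 * (k%:R / N%:R) * (N%:R / 2) :> R by field; rewrite gt_eqF.
  apply: ler_pM => //; rewrite ?mulr_ge0 ?divr_ge0//.
  by rewrite ler_wpM2l// ler_wpM2r// invr_ge0.
have u2 : u ^+ 2 <= 4 * c ^+ 2.
  rewrite -real_normK ?num_real//.
  by have := normr_ge0 u; nra.
have uhalf : `|u| <= 1 / 2 by lra.
have lo := expR_sub_sqr_le uhalf; have up := expR_ge1Dx u.
have /ler_normlP[uw1 uw2] := uw.
have ratioE : falling_ratio R N m k.+1 / p ^+ k.+1 = falling_ratio R N m k / p ^+ k * (1 + u).
  rewrite falling_ratioS exprS.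
  have -> : (m - k)%N%:R = m%:R - k%:R :> R by rewrite natrB// (leq_trans (ltnW kl)).
  have -> : (N - k)%N%:R = d.
    by rewrite /d natrB// (leq_trans (ltnW kl))// (leq_trans _ lN)// leq_pmull.
  have -> : 1 + u = (m%:R - k%:R) / d / p.
    rewrite /u /z /y /P /d; field; rewrite -/d !gt_eqF//.
  by field; rewrite expf_neq0 ?gt_eqF.
have wE : w k.+1 = w k + z / P.
  by rewrite /w /z -natr1; field; rewrite gt_eqF.
have r0 : 0 <= falling_ratio R N m k / p ^+ k.
  by rewrite divr_ge0 ?falling_ratio_ge0 ?exprn_ge0 ?ltW.
rewrite ratioE wE -natr1; apply/andP; split.
- have -> : w k + z / P - (k%:R + 1) * eta = (w k - k%:R * eta) + (z / P - eta) by ring.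
  rewrite expRD; apply: ler_pM; rewrite ?expR_ge0//.
  by apply: le_trans lo; rewrite ler_expR etaE; lra.
- have -> : w k + z / P + (k%:R + 1) * eta = (w k + k%:R * eta) + (z / P + eta) by ring.
  rewrite expRD; apply: ler_pM => //.
    by case/ler_normlP: uhalf => *; lra.
  by apply: le_trans up _; rewrite ler_expR etaE; have := sqr_ge0 c; lra.
Qed.

End conditional_mean_asymptotics.

(** * Comparison of the normalized logarithm with the standardized edge count *)

Section log_matchings_approximation.
Variables (R : realType) (n : nat) (p : R) (l : nat) (A kappa beta0 eps : R).

Local Notation N := 'C(n, 2).
Let P := p * N%:R.
Let s := Num.sqrt (N%:R * p * (1 - p)).
Local Notation beta := (beta_nl n p l).
Local Notation x := (@standardized R N p).

Hypothesis p01 : 0 < p < 1.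
Hypothesis l0 : (0 < l)%N.
Hypothesis ln : (2 * l < n)%N.
Hypothesis A1 : 1 <= A.
Hypothesis kappa0 : 0 < kappa.
Hypothesis kappaA : 16 * A * kappa <= 1.
Hypothesis beta00 : 0 < beta0.
Hypothesis beta0_le : beta0 <= beta.
Hypothesis eps0 : 0 < eps.
Hypothesis lP : l%:R <= kappa * P.
Hypothesis sP : s <= kappa * P.
Hypothesis l3P : l%:R ^+ 3 <= kappa * P ^+ 2.
Hypothesis kappa_eps : kappa * (2 * A + 16 * A ^+ 2 + 19 / beta0) <= eps / 2.

Let p0 : 0 < p. Proof. by case/andP: p01. Qed.
Let q0 : 0 < 1 - p. Proof. by case/andP: p01 => *; rewrite subr_gt0. Qed.
Let N0 : (0 < N)%N. Proof. by rewrite bin_gt0 (leq_ltn_trans _ ln)// muln_gt0. Qed.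
Let N0' : 0 < N%:R :> R. Proof. by rewrite ltr0n. Qed.
Let P0 : 0 < P. Proof. by rewrite mulr_gt0. Qed.
Let v0 : 0 < N%:R * p * (1 - p). Proof. by rewrite !mulr_gt0. Qed.
Let s0 : 0 < s. Proof. by rewrite sqrtr_gt0. Qed.
Let s2 : s ^+ 2 = P * (1 - p).
Proof. by rewrite sqr_sqrtr ?ltW// /P; ring. Qed.

(** [s / P] is the relative standard deviation of the edge count, and the conditional mean varies
    roughly as its [l]-th power; this is why [beta] is the right scale for the logarithm. *)
Lemma beta_nlE : beta = l%:R * (s / P).
Proof.
rewrite /beta_nl; congr (_ * _).
have -> : (1 - p) / (p * N%:R) = (s / P) ^+ 2.
  by rewrite expr_div_n s2 /P; field; rewrite !gt_eqF.
by rewrite sqrtr_sqr ger0_norm// divr_ge0// ltW.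
Qed.

Let beta_gt0 : 0 < beta. Proof. exact: lt_le_trans beta0_le. Qed.

Let kappa16 : kappa <= 1 / 16.
Proof.
have := ler_wpM2r (ltW kappa0) A1; have := kappaA; rewrite mul1r -mulrA; lra.
Qed.

Let AsP : A * s <= P / 16.
Proof.
have A0 : 0 <= A by have := A1; lra.
apply: le_trans (ler_wpM2l A0 sP) _.
by have := ler_wpM2r (ltW P0) kappaA; lra.
Qed.

Let lP16 : l%:R <= P / 16.
Proof. by apply: le_trans lP _; have := ler_wpM2r (ltW P0) kappa16; lra. Qed.

Let PN : P <= N%:R.
Proof. by rewrite /P ler_piMl// ltW//; case/andP: p01. Qed.

Let size_ge m : `|m%:R - P| <= A * s -> P / 2 <= m%:R.
Proof. by move=> /ler_normlP[H _]; have := AsP; have := P0; lra. Qed.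

Let size_gt m : `|m%:R - P| <= A * s -> (2 * l < m)%N.
Proof.
move=> /size_ge H; rewrite -(ltr_nat R) natrM; have := lP16; have := P0; lra.
Qed.

Let size_second_moment m : `|m%:R - P| <= A * s ->
  2 * l%:R ^+ 3 / (m%:R * (m%:R - 2 * l%:R)) <= 16 * kappa.
Proof.
move=> /size_ge H.
have H2 : P / 4 <= m%:R - 2 * l%:R by have := lP16; have := P0; lra.
have Pm : P ^+ 2 / 8 <= m%:R * (m%:R - 2 * l%:R).
  have -> : P ^+ 2 / 8 = (P / 2) * (P / 4) by field.
  by apply: ler_pM => //; rewrite divr_ge0// ltW.
have P2 : 0 < P ^+ 2 / 8 by rewrite divr_gt0// exprn_gt0.
rewrite ler_pdivrMr; last exact: lt_le_trans Pm.
have k16 : 0 <= 16 * kappa by rewrite mulr_ge0// ltW.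
apply: le_trans (ler_wpM2l k16 Pm); have := l3P; lra.
Qed.

Lemma conditional_mean_lognormal m : `|m%:R - P| <= A * s ->
  expR (beta * (x m - eps / 2) - beta ^+ 2 / 2)
    <= falling_ratio R N m l / p ^+ l
    <= expR (beta * (x m + eps / 2) - beta ^+ 2 / 2).
Proof.
move=> mP.
have lm : (l <= m)%N by apply/ltnW; apply: leq_ltn_trans (size_gt mP); rewrite leq_pmull.
have lN : (2 * l <= N)%N.
  by rewrite -(ler_nat R) natrM; have := lP16; have := PN; have := P0; lra.
have BP : 4 * (A * s + l%:R) <= p * N%:R.
  by have := AsP; have := lP16; have := P0; rewrite -/P; lra.
have := falling_ratio_exp p01 N0 lN lm mP BP (leqnn l).
rewrite -/P.
set w := (_ / P).
pose eta := 2 * l%:R * (A * s + l%:R) / (P * N%:R) + 8 * (A * s + l%:R) ^+ 2 / P ^+ 2.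
rewrite -/eta => /andP[lo up].
set a1 := l%:R / P; set a2 := s / P.
have a10 : 0 <= a1 by rewrite divr_ge0// ltW.
have a20 : 0 <= a2 by rewrite divr_ge0// ltW.
have a1k : a1 <= kappa by rewrite ler_pdivrMr.
have a2k : a2 <= kappa by rewrite ler_pdivrMr.
have L0 : 0 <= l%:R :> R by [].
have la1 : l%:R * a1 ^+ 2 <= kappa.
  have -> : l%:R * a1 ^+ 2 = l%:R ^+ 3 / P ^+ 2 by rewrite /a1; field; rewrite gt_eqF.
  by rewrite ler_pdivrMr// exprn_gt0.
have bE : beta = l%:R * a2 by exact: beta_nlE.
(* The linear term l (m - P) / P is [beta * x m]. The quadratic one is -(1 - p) l (l - 1) / (2P),
   whose l^2 part is exactly -beta^2 / 2. *)
have wE : w = beta * x m - beta ^+ 2 / 2 + (1 - p) * a1 / 2.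
  have -> : beta ^+ 2 = l%:R ^+ 2 * (1 - p) / P.
    by rewrite bE exprMn /a2 expr_div_n s2; field; rewrite gt_eqF.
  rewrite bE /standardized -/s -/P /w /a1 /a2; field.
  by rewrite !gt_eqF.
have etaE : eta <= 2 * a1 * (A * a2 + a1) + 8 * (A * a2 + a1) ^+ 2.
  have e1 : A * a2 + a1 = (A * s + l%:R) / P by rewrite /a1 /a2; field; rewrite gt_eqF.
  rewrite /eta e1 expr_div_n [8 * (_ / _)]mulrA lerD2r.
  have -> : 2 * a1 * ((A * s + l%:R) / P) = 2 * l%:R * (A * s + l%:R) / (P * P).
    by rewrite /a1; field; rewrite gt_eqF.
  rewrite ler_wpM2l ?lef_pV2 ?posrE ?mulr_gt0//; last by rewrite ler_wpM2l// ltW.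
  by rewrite !mulr_ge0// addr_ge0// mulr_ge0//; [have := A1; lra|exact: ltW].
(* Products containing s / P carry a factor [beta]; what remains is l^3 / P^2, at most [kappa]. The
   18 is 2 + 16, the 16 arising from bounding the square of a sum. *)
have leta : l%:R * eta <= beta * kappa * (2 * A + 16 * A ^+ 2) + 18 * kappa.
  apply: le_trans (ler_wpM2l L0 etaE) _.
  have sq : (A * a2 + a1) ^+ 2 <= 2 * (A ^+ 2 * a2 ^+ 2 + a1 ^+ 2).
    by have := sqr_ge0 (A * a2 - a1); rewrite -exprMn; lra.
  have t1 : l%:R * (2 * a1 * (A * a2 + a1) + 8 * (A * a2 + a1) ^+ 2)
     <= beta * (2 * A * a1 + 16 * A ^+ 2 * a2) + 18 * (l%:R * a1 ^+ 2).
    by have := ler_wpM2l L0 sq; rewrite bE; lra.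
  apply: le_trans t1 _; apply: lerD; last by rewrite ler_wpM2l.
  rewrite -[leRHS]mulrA; apply: ler_wpM2l (ltW beta_gt0) _ _ _.
  have A0 : 0 <= 2 * A by have := A1; lra.
  have A20 : 0 <= 16 * A ^+ 2 by rewrite mulr_ge0// sqr_ge0.
  by rewrite mulrDr [kappa * _]mulrC [kappa * _]mulrC; apply: lerD; rewrite ler_wpM2l.
have err : l%:R * eta + (1 - p) * a1 / 2 <= beta * (eps / 2).
  (* Errors without a factor [beta] are absorbed through beta >= beta0; 19 is the above 18 plus one
     for the linear remainder (1 - p) l / (2P). *)
  have kb : kappa <= beta * (kappa / beta0).
    rewrite mulrA ler_pdivlMr// mulrC ler_wpM2r//; exact: ltW.
  have qa : (1 - p) * a1 <= kappa.
    by apply: le_trans a1k; rewrite ler_piMl//; have := p0; lra.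
  apply: le_trans (ler_wpM2l (ltW beta_gt0) kappa_eps).
  have -> : beta * (kappa * (2 * A + 16 * A ^+ 2 + 19 / beta0))
     = beta * kappa * (2 * A + 16 * A ^+ 2) + 19 * (beta * (kappa / beta0)).
    by field; rewrite gt_eqF.
  have := ltW kappa0; lra.
have qa0 : 0 <= (1 - p) * a1 by rewrite mulr_ge0// ltW.
apply/andP; split.
  by apply: le_trans lo; rewrite ler_expR wE; lra.
by apply: le_trans up _; rewrite ler_expR wE; lra.
Qed.

Let normalized (G : graph n) : R :=
  expR (beta ^+ 2 / 2) * (num_matchings l G)%:R / gnp_mean n p l.

Lemma log_matchings_le (t : R) (G : graph n) :
  (log_matchings p l G <= t%:E)%E = (normalized G <= expR (beta * t)).
Proof.
rewrite /log_matchings -/(normalized G).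
(* A vanishing count gives the logarithm -oo, which survives the division by a positive [beta], so
   both sides are true. *)
have [W0|W0] := leP (normalized G) 0.
  rewrite (le_trans W0 (expR_ge0 _)) le0_lneNy ?lee_fin//.
  by rewrite mulNyr gtr0_sg ?invr_gt0// mul1e leNye.
rewrite lne_EFin// -EFinM lee_fin ler_pdivrMr// -[in RHS](lnK (x := normalized G)) ?posrE//.
by rewrite ler_expR mulrC.
Qed.

Variable eps' : R.
Hypothesis eps'0 : 0 < eps' <= 1 / 2.
Hypothesis eps'_le : 2 * eps' <= beta0 * (eps / 2).

Let mean m := conditional_mean R n l m.

(** Half of [eps] is spent on the conditional mean. The other half absorbs the factor 1 - eps' or 1
    + eps', which differs from 1 by at most 2 eps' in the logarithm. *)
Lemma normalized_matchings_approx (G : graph n) :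
  `|#|G|%:R - P| <= A * s ->
  `|(num_matchings l G)%:R - mean #|G| | <= eps' * mean #|G| ->
  expR (beta * (x #|G| - eps)) <= normalized G <= expR (beta * (x #|G| + eps)).
Proof.
move=> GP; have /andP[e0 e1] := eps'0.
have /andP[lo up] := conditional_mean_lognormal GP.
set c := mean _ => /ler_normlP[X1 X2].
have p01' : 0 <= p <= 1 by case/andP: p01 => *; rewrite !ltW.
set rho := falling_ratio R N #|G| l / p ^+ l in lo up.
set F : R := #|matchings n l|%:R.
have F0 : 0 < F by rewrite ltr0n card_matchings_gt0.
have pl0 : 0 < p ^+ l by rewrite exprn_gt0.
have cE : c = F * p ^+ l * rho.
  by rewrite /rho /c /mean /conditional_mean -/F; field; rewrite gt_eqF.
have Fp : 0 < F * p ^+ l by rewrite mulr_gt0.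
have WE : normalized G = expR (beta ^+ 2 / 2) * ((num_matchings l G)%:R / (F * p ^+ l)).
  by rewrite /normalized (gnp_mean_matchings _ _ p01') -/F mulrA.
have be : 2 * eps' <= beta * (eps / 2).
  by apply: le_trans eps'_le _; rewrite ler_wpM2r// divr_ge0// ltW.
have rho0 : 0 <= rho by apply: le_trans lo; exact: expR_ge0.
have W1 : (1 - eps') * rho <= (num_matchings l G)%:R / (F * p ^+ l) <= (1 + eps') * rho.
  apply/andP; split.
    rewrite ler_pdivlMr//.
    have -> : (1 - eps') * rho * (F * p ^+ l) = c - eps' * c by rewrite cE; ring.
    lra.
  rewrite ler_pdivrMr//.
  have -> : (1 + eps') * rho * (F * p ^+ l) = c + eps' * c by rewrite cE; ring.
  lra.
have /andP[W1l W1u] := W1.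
have B0 := expR_ge0 (beta ^+ 2 / 2).
rewrite WE; apply/andP; split.
- apply: le_trans (ler_wpM2l B0 W1l).
  have m1 : expR (- (2 * eps')) <= 1 - eps'.
    have h : `|- eps'| <= 1 / 2 by rewrite normrN ger0_norm// ltW.
    apply: le_trans (expR_sub_sqr_le h); rewrite ler_expR sqrrN.
    have : 0 <= eps' * (1 - 2 * eps') by apply: mulr_ge0; lra.
    lra.
  apply: le_trans (ler_wpM2l B0 (ler_pM (expR_ge0 _) (expR_ge0 _) m1 lo)).
  by rewrite -!expRD ler_expR; lra.
- apply: le_trans (ler_wpM2l B0 W1u) _.
  have e0' : 0 <= 1 + eps' by lra.
  apply: le_trans (ler_wpM2l B0 (ler_pM e0' rho0 (expR_ge1Dx eps') up)) _.
  by rewrite -!expRD ler_expR; lra.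
Qed.

(** Outside the exceptional graphs, x <= t - eps implies that the normalized logarithm is at most t,
    which implies x <= t + eps; the exceptional mass is at most [bad]. *)
Lemma log_matchings_sandwich (t bad : R) :
  A ^- 2 + (expR (16 * kappa) - 1) / eps' ^+ 2 <= bad ->
  \sum_(G : graph n | x #|G| <= t - eps) gnp_pmf p G - bad
  <= \sum_(G : graph n | (log_matchings p l G <= t%:E)%E) gnp_pmf p G
  <= \sum_(G : graph n | x #|G| <= t + eps) gnp_pmf p G + bad.
Proof.
move=> badE; have /andP[e0 e1] := eps'0.
have p01' : 0 <= p <= 1 by case/andP: p01 => *; rewrite !ltW.
have A0 : 0 < A by exact: lt_le_trans A1.
have near_le m : (m%:R - p * N%:R) ^+ 2 <= A ^+ 2 * (N%:R * p * (1 - p)) ->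
    `|m%:R - P| <= A * s.
  move=> H; rewrite -(ler_pXn2r (_ : 0 < 2)%N) ?nnegrE ?mulr_ge0 ?sqrtr_ge0 ?(ltW A0)//.
  by rewrite real_normK ?num_real// exprMn sqr_sqrtr// (ltW v0).
have d0 : 0 <= 16 * kappa by rewrite mulr_ge0// ltW.
have := concentration p01' ln A0 e0 d0
  (fun m H _ => conj (size_gt (near_le m H)) (size_second_moment (near_le m H))).
pose badP (G : graph n) := (A ^+ 2 * (N%:R * p * (1 - p)) < (#|G|%:R - p * N%:R) ^+ 2)
  || (eps' * mean #|G| < `|(num_matchings l G)%:R - mean #|G| |).
move=> /le_trans/(_ badE) conc0.
have {conc0} conc : \sum_(G | badP G) gnp_pmf p G <= bad by exact: conc0.
have w0 (G : graph n) : 0 <= gnp_pmf p G by exact: gnp_pmf_ge0.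
have good (G : graph n) : ~~ badP G ->
    expR (beta * (x #|G| - eps)) <= normalized G <= expR (beta * (x #|G| + eps)).
  rewrite /badP negb_or -!leNgt => /andP[/near_le GP dev].
  exact: normalized_matchings_approx.
apply/andP; split.
- rewrite lerBlDr; apply: le_trans (lerD (lexx _) conc).
  rewrite big_mkcond [X in _ <= X + _]big_mkcond [X in _ <= _ + X]big_mkcond/=.
  rewrite -big_split/=; apply: ler_sum => G _.
  have [bG|/good/andP[_ gG]] := boolP (badP G).
    by case: ifP; case: ifP; rewrite ?add0r ?addr0 ?lerDl ?addr_ge0.
  rewrite addr0 log_matchings_le; case: ifP => [xG|_]; last by case: ifP.
  rewrite ifT//; apply: le_trans gG _.
  by rewrite ler_expR ler_wpM2l ?(ltW beta_gt0)//; lra.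
- apply: le_trans (lerD (lexx _) conc).
  rewrite big_mkcond [X in _ <= X + _]big_mkcond [X in _ <= _ + X]big_mkcond/=.
  rewrite -big_split/=; apply: ler_sum => G _.
  have [bG|/good/andP[gG _]] := boolP (badP G).
    by case: ifP; case: ifP; rewrite ?add0r ?addr0 ?lerDl ?addr_ge0.
  rewrite addr0 log_matchings_le; case: ifP => [xG|_]; last by case: ifP.
  rewrite ifT//; have := le_trans gG xG.
  by rewrite ler_expR ler_pM2l//; lra.
Qed.

End log_matchings_approximation.

(** * Asymptotics *)

Section asymptotics.
Local Open Scope classical_set_scope.
Variable R : realType.

Lemma eqOmega_lower_bound (f g : nat -> R^o) : f =Omega_\oo g ->
  exists2 c : R, 0 < c & \forall n \near \oo, c * `|g n| <= `|f n|.
Proof. by rewrite eqOmegaE qualifE => /asboolP[c c0 H]; exists c. Qed.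

Lemma bin2_bounds n : (2 <= n)%N ->
  n%:R ^+ 2 / 4 <= 'C(n, 2)%:R :> R /\ 'C(n, 2)%:R <= n%:R ^+ 2 / 2 :> R.
Proof.
move=> n2.
have : 'C(n, 2)%:R * 2 = n%:R * (n%:R - 1) :> R.
  rewrite -(natrM R _ 2) (_ : 'C(n, 2) * 2 = n * (n - 1))%N ?natrM ?natrB//; first exact: ltnW.
  by have := bin_ffact n 2; rewrite ffactnS ffactn1 -subn1.
have : 2 <= n%:R :> R by rewrite ler_nat.
by move=> n2' E; split; nra.
Qed.

Variables (alpha : R) (p : nat -> R) (l : nat -> nat).
Hypothesis alpha01 : 7 / 8 < alpha < 1.
Hypothesis p01 : forall n, 0 < p n < 1.
Hypothesis np_oo : n%:R * p n @[n --> \oo] --> +oo.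
Hypothesis q_Omega : (fun n => 1 - p n : R^o) =Omega_\oo (fun=> 1 : R^o).
Hypothesis l_gt0 : forall n, (0 < l n)%N.
Hypothesis l_Omega :
  (fun n => (l n)%:R : R^o) =Omega_\oo (fun n => n%:R * Num.sqrt (p n) : R^o).
Hypothesis l_le : \forall n \near \oo, (l n)%:R <= n%:R / 2 - n%:R `^ alpha.
Hypothesis l3_o :
  (fun n => (l n)%:R ^+ 3 : R^o) =o_\oo (fun n => n%:R ^+ 4 * p n ^+ 2 : R^o).

Let P n := p n * 'C(n, 2)%:R.
Let v n := 'C(n, 2)%:R * p n * (1 - p n).

Let P_ge n : (2 <= n)%N -> n%:R * (n%:R * p n) / 4 <= P n.
Proof.
move=> n2; have [H _] := bin2_bounds n2; have /andP[p0 _] := p01 n.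
rewrite /P; have := ler_wpM2l (ltW p0) H; lra.
Qed.

Lemma near_twice_lt : \forall n \near \oo, (2 * l n < n)%N.
Proof.
near=> n.
have n1 : 1 <= n%:R :> R by rewrite ler1n; near: n; exact: nbhs_infty_ge.
have a1 : 1 <= n%:R `^ alpha.
  rewrite -[leLHS](powRr0 n%:R); apply: (ler_powR n1).
  by case/andP: alpha01 => *; lra.
have H : (l n)%:R <= n%:R / 2 - n%:R `^ alpha by near: n; exact: l_le.
by rewrite -(ltr_nat R) natrM; lra.
Unshelve. all: by end_near. Qed.

Lemma near_edges_ge (V : R) : \forall n \near \oo, V <= P n.
Proof.
near=> n.
have n2 : (2 <= n)%N by near: n; exact: nbhs_infty_ge.
apply: le_trans (P_ge n2).
have n2' : 2 <= n%:R :> R by rewrite ler_nat.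
have H : `|V| * 2 <= n%:R * p n by near: n; move/cvgryPge : np_oo; exact.
have := ler_norm V; have := normr_ge0 V; nra.
Unshelve. all: by end_near. Qed.

Lemma near_variance_ge (V : R) : \forall n \near \oo, V <= v n.
Proof.
have [c c0 qc] := eqOmega_lower_bound q_Omega.
near=> n.
have /andP[p0 p1] := p01 n.
have qn : c <= 1 - p n.
  have : c * `|1 : R^o| <= `|1 - p n| by near: n; exact: qc.
  by rewrite normr1 mulr1 ger0_norm//; lra.
have H : `|V| / c <= P n by near: n; exact: near_edges_ge.
rewrite (_ : v n = P n * (1 - p n)); last by rewrite /v /P; ring.
apply: le_trans (ler_norm V) _; rewrite ler_pdivrMr// in H.
apply: le_trans H _; rewrite ler_wpM2l// /P mulr_ge0// ltW//.
Unshelve. all: by end_near. Qed.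

(** The square roots of p in the lower bound for [l] and in [beta] cancel, leaving 1 - p, which is
    bounded below, and n^2 / N, which is at least 1. *)
Lemma near_beta_ge : exists2 b : R, 0 < b &
  \forall n \near \oo, b <= beta_nl n (p n) (l n).
Proof.
have [c c0 qc] := eqOmega_lower_bound q_Omega.
have [d d0 ld] := eqOmega_lower_bound l_Omega.
exists (d * Num.sqrt c); first by rewrite mulr_gt0// sqrtr_gt0.
near=> n.
have /andP[p0 p1] := p01 n.
have n2 : (2 <= n)%N by near: n; exact: nbhs_infty_ge.
have n0 : 0 < n%:R :> R by rewrite ltr0n; exact: ltn_trans n2.
have [N1 N2] := bin2_bounds n2.
have N0 : 0 < 'C(n, 2)%:R :> R by rewrite ltr0n bin_gt0.
have qn : c <= 1 - p n.
  have : c * `|1 : R^o| <= `|1 - p n| by near: n; exact: qc.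
  by rewrite normr1 mulr1 ger0_norm//; lra.
have ln : d * (n%:R * Num.sqrt (p n)) <= (l n)%:R.
  have : d * `|n%:R * Num.sqrt (p n) : R^o| <= `|(l n)%:R| by near: n; exact: ld.
  by rewrite !ger0_norm// mulr_ge0// sqrtr_ge0.
rewrite /beta_nl.
apply: le_trans (_ : d * (n%:R * Num.sqrt (p n))
  * Num.sqrt ((1 - p n) / (p n * 'C(n, 2)%:R)) <= _); last first.
  by rewrite ler_wpM2r ?sqrtr_ge0.
rewrite -!mulrA ler_wpM2l ?(ltW d0)// -sqrtrM ?(ltW p0)//.
rewrite -{1}(ger0_norm (ltW n0)) -sqrtr_sqr -sqrtrM ?sqr_ge0// ler_wsqrtr//.
have -> : n%:R ^+ 2 * (p n * ((1 - p n) / (p n * 'C(n, 2)%:R)))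
  = (1 - p n) * (n%:R ^+ 2 / 'C(n, 2)%:R) by field; rewrite !gt_eqF.
apply: le_trans qn _; rewrite ler_peMr//; first lra.
by rewrite ler_pdivlMr// mul1r; lra.
Unshelve. all: by end_near. Qed.

Lemma near_small (kappa : R) : 0 < kappa -> \forall n \near \oo,
  [/\ (l n)%:R <= kappa * P n, Num.sqrt (v n) <= kappa * P n
    & (l n)%:R ^+ 3 <= kappa * P n ^+ 2].
Proof.
(* The 16 comes from P >= n^2 p / 4, squared. *)
move=> k0; have e0 : 0 < kappa / 16 by rewrite divr_gt0.
have /eqoP/(_ _ e0) l3 := l3_o.
near=> n; have /andP[p0 p1] := p01 n.
have n2 : (2 <= n)%N by near: n; exact: nbhs_infty_ge.
have n0 : 0 < n%:R :> R by rewrite ltr0n; exact: ltn_trans n2.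
have PP := P_ge n2.
have P0 : 0 < P n by rewrite mulr_gt0// ltr0n bin_gt0.
have ln : 2 * (l n)%:R <= n%:R :> R.
  by rewrite -natrM ler_nat ltnW//; near: n; exact: near_twice_lt.
have np2 : 2 / kappa <= n%:R * p n by near: n; move/cvgryPge : np_oo; exact.
rewrite ler_pdivrMr// in np2.
split.
- apply: le_trans (_ : n%:R / 2 <= _); first by lra.
  apply: le_trans (ler_wpM2l (ltW k0) PP).
  by have := ler_wpM2l (ltW n0) np2; lra.
- have Pk : kappa ^- 2 <= P n by near: n; exact: near_edges_ge.
  have -> : kappa * P n = Num.sqrt ((kappa * P n) ^+ 2).
    by rewrite sqrtr_sqr ger0_norm// ltW// mulr_gt0.
  apply: ler_wsqrtr.
  rewrite (_ : v n = P n * (1 - p n)); last by rewrite /v /P; ring.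
  apply: le_trans (_ : P n <= _); first by rewrite ler_piMr// ?(ltW P0)//; lra.
  have k2 : 0 < kappa ^+ 2 by rewrite exprn_gt0.
  rewrite -[kappa ^- 2]mul1r ler_pdivrMr// in Pk.
  by rewrite exprMn expr2 [P n ^+ 2]expr2 mulrA ler_peMl ?(ltW P0)// -expr2 mulrC.
- have : `|(l n)%:R ^+ 3 : R^o| <= kappa / 16 * `|n%:R ^+ 4 * p n ^+ 2 : R^o|.
    by near: n; exact: l3.
  rewrite !ger0_norm ?mulr_ge0 ?exprn_ge0 ?(ltW p0)// => /le_trans; apply.
  have -> : kappa / 16 * (n%:R ^+ 4 * p n ^+ 2) = kappa * (n%:R * (n%:R * p n) / 4) ^+ 2.
    by field.
  rewrite ler_wpM2l ?(ltW k0)// lerXn2r// nnegrE ?(ltW P0)//.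
  by rewrite divr_ge0// !mulr_ge0// ltW.
Unshelve. all: by end_near. Qed.

End asymptotics.

(** * Choice of the constants and the limit theorem *)

Local Open Scope classical_set_scope.
Local Open Scope ring_scope.

Lemma near_log_matchings_Phi (R : realType) (alpha : R) (p : nat -> R)
    (l : nat -> nat) (t e : R) :
  7 / 8 < alpha < 1 ->
  (forall n, 0 < p n < 1) ->
  n%:R * p n @[n --> \oo] --> +oo ->
  (fun n => 1 - p n : R^o) =Omega_\oo (fun=> 1 : R^o) ->
  (forall n, (0 < l n)%N) ->
  (fun n => (l n)%:R : R^o) =Omega_\oo (fun n => n%:R * Num.sqrt (p n) : R^o) ->
  (\forall n \near \oo, (l n)%:R <= n%:R / 2 - n%:R `^ alpha) ->
  (fun n => (l n)%:R ^+ 3 : R^o) =o_\oo (fun n => n%:R ^+ 4 * p n ^+ 2 : R^o) ->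
  0 < e -> \forall n \near \oo,
  `|\sum_(G : graph n | (log_matchings (p n) (l n) G <= t%:E)%E) gnp_pmf (p n) G
    - Phi t| <= e.
Proof.
move=> alpha01 p01 np_oo q_Omega l_gt0 l_Omega l_le l3_o e0.
have [beta0 beta00 beta0_le] := near_beta_ge p01 q_Omega l_Omega.
(* Error budget: 10 eta for the central limit theorem, 2 eta for exceptional graphs and eta for
   shifting t by [eps]. *)
pose eta := Num.min (e / 13) (1 / 8).
have eta0 : 0 < eta by rewrite lt_min !divr_gt0.
have eta8 : eta <= 1 / 8 by rewrite ge_min lexx orbT.
have eta_e : 13 * eta <= e.
  have : eta <= e / 13 by rewrite ge_min lexx.
  lra.
have c0 : 0 <= normal_peak 1 :> R by exact: normal_peak_ge0.
pose eps := eta / (normal_peak 1 + 1).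
have eps0 : 0 < eps by rewrite divr_gt0// ltr_wpDl.
have eps1 : eps <= 1.
  by rewrite ler_pdivrMr ?ltr_wpDl//; lra.
have ceps : normal_peak 1 * eps <= eta.
  rewrite mulrCA ler_piMr ?(ltW eta0)// ler_pdivrMr ?ltr_wpDl// mul1r.
  by rewrite lerDl.
have [A [A1 At Aeta PhiN PhiA]] : exists A : R,
    [/\ 1 <= A, `|t| + 1 <= A, (A / 2) ^- 2 <= eta, Phi (- A) <= eta & 1 - eta <= Phi A].
  near (pinfty_nbhs R) => A.
  have [PhiN PhiA] : Phi (- A) <= eta /\ 1 - eta <= Phi A.
    by near: A; exact: Phi_tails.
  exists A; split; [| | |exact: PhiN|exact: PhiA].
  - by near: A; apply: nbhs_pinfty_ge; rewrite num_real.
  - by near: A; apply: nbhs_pinfty_ge; rewrite num_real.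
  - have A2 : 2 / eta <= A by near: A; apply: nbhs_pinfty_ge; rewrite num_real.
    rewrite ler_pdivrMr// in A2.
    set B := A / 2.
    have Ae : 1 <= eta * B by rewrite /B; lra.
    have Ag : 0 < B by rewrite -(pmulr_rgt0 _ eta0); lra.
    have B1 : 1 <= B by have := ler_wpM2r (ltW Ag) eta8; lra.
    rewrite -[leLHS]mul1r ler_pdivrMr ?exprn_gt0//; apply: le_trans Ae _.
    by rewrite ler_pM2l// expr2 ler_peMr// ltW.
have A0 : 0 < A by exact: lt_le_trans A1.
pose eps' := Num.min (1 / 2) (beta0 * eps / 4).
have eps'0 : 0 < eps' by rewrite lt_min !divr_gt0// mulr_gt0.
have eps'1 : eps' <= 1 / 2 by rewrite ge_min lexx.
have eps'_le : 2 * eps' <= beta0 * (eps / 2).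
  have : eps' <= beta0 * eps / 4 by rewrite ge_min lexx orbT.
  lra.
pose K := 2 * A + 16 * A ^+ 2 + 19 / beta0.
have K0 : 0 < K by rewrite !addr_gt0 ?divr_gt0 ?mulr_gt0 ?exprn_gt0.
(* The three bounds respectively keep the window well inside the range of edge counts, hold the
   error in the logarithm to eps / 2, and make the exceptional conditional mass at most [eta]. *)
pose kappa := Num.min (1 / (32 * A)) (Num.min (eps / 2 / K) (eta * eps' ^+ 2 / 32)).
have kappa0 : 0 < kappa.
  rewrite !lt_min; apply/and3P; split.
  - by rewrite divr_gt0// mulr_gt0.
  - by apply: divr_gt0 => //; exact: divr_gt0.
  - by rewrite divr_gt0// mulr_gt0// exprn_gt0.
have kappaA : 32 * A * kappa <= 1.
  have : kappa <= 1 / (32 * A) by rewrite ge_min lexx.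
  by rewrite ler_pdivlMr ?mulr_gt0// mulrC.
have kappa_eps : kappa * K <= eps / 2.
  have : kappa <= eps / 2 / K by rewrite !ge_min lexx orbT.
  by rewrite ler_pdivlMr.
have kappa_eta : (expR (16 * kappa) - 1) / eps' ^+ 2 <= eta.
  have : kappa <= eta * eps' ^+ 2 / 32 by rewrite !ge_min lexx !orbT.
  rewrite ler_pdivrMr ?exprn_gt0// => h.
  have k16 : 0 <= 16 * kappa <= 1 / 2.
    by have := ler_wpM2r (ltW kappa0) A1; lra.
  by have := expR_le1D2x k16; lra.
have bad_le : A ^- 2 + (expR (16 * kappa) - 1) / eps' ^+ 2 <= 2 * eta.
  have : A ^- 2 <= eta.
    apply: le_trans Aeta; rewrite lef_pV2 ?posrE ?exprn_gt0 ?divr_gt0//.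
    by rewrite lerXn2r ?nnegrE ?divr_ge0 ?(ltW A0)//; lra.
  lra.
pose kappa_clt := 6 * A * (A + 1) ^+ 2 + 2 * (A + 1).
have kc0 : 0 < kappa_clt by rewrite addr_gt0 ?mulr_gt0 ?exprn_gt0 ?addr_gt0.
(* A variance of at least [V] makes both step-size conditions of [edge_count_clt_window] hold. *)
pose V := ((2 * kappa_clt + normal_peak 1) / eta) ^+ 2.
have V0 : 0 < (2 * kappa_clt + normal_peak 1) / eta.
  by apply: divr_gt0 => //; apply: ltr_pwDl => //; exact: mulr_gt0.
have small := near_small alpha01 p01 np_oo l_le l3_o kappa0.
have variance_ge := near_variance_ge p01 np_oo q_Omega V.
near=> n.
have ln : (2 * l n < n)%N by near: n; exact: near_twice_lt alpha01 l_le.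
have betan : beta0 <= beta_nl n (p n) (l n) by near: n.
have [lP sP l3P] : [/\ (l n)%:R <= kappa * (p n * 'C(n, 2)%:R),
    Num.sqrt ('C(n, 2)%:R * p n * (1 - p n)) <= kappa * (p n * 'C(n, 2)%:R)
  & (l n)%:R ^+ 3 <= kappa * (p n * 'C(n, 2)%:R) ^+ 2].
  by near: n.
have Vv : V <= 'C(n, 2)%:R * p n * (1 - p n) by near: n.
set v := 'C(n, 2)%:R * p n * (1 - p n) in Vv.
have v0 : 0 < v by apply: lt_le_trans Vv; exact: exprn_gt0.
have s0 : 0 < Num.sqrt v by rewrite sqrtr_gt0.
have sV : (2 * kappa_clt + normal_peak 1) <= eta * Num.sqrt v.
  have : Num.sqrt V <= Num.sqrt v by exact: ler_wsqrtr.
  rewrite /V sqrtr_sqr (ger0_norm (ltW V0)) ler_pdivrMr// => /le_trans; apply.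
  by rewrite mulrC.
have h1 : 2 * kappa_clt * (Num.sqrt v)^-1 <= eta.
  by rewrite ler_pdivrMr//; apply: le_trans sV; rewrite lerDl.
have h2 : normal_peak 1 * (Num.sqrt v)^-1 <= eta.
  by rewrite ler_pdivrMr//; apply: le_trans sV; rewrite lerDr mulr_ge0// ltW.
have eta01 : 0 < eta <= 1 / 8 by rewrite eta0.
have clt u : - A <= u <= A ->
    `|\sum_(G : graph n | standardized 'C(n, 2) (p n) #|G| <= u) gnp_pmf (p n) G - Phi u|
    <= 10 * eta.
  by move=> uA; exact: (edge_count_clt_window (p01 n) eta01 A1 uA Aeta PhiN PhiA v0 h1 h2).
have tA := ler_norm t; have tA' := ler_norm (- t); rewrite normrN in tA'.
have /clt/ler_normlP[_ clt_up] : - A <= t + eps <= A.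
  by apply/andP; split; move: tA tA' At eps0 eps1; clear; lra.
have /clt/ler_normlP[clt_lo _] : - A <= t - eps <= A.
  by apply/andP; split; move: tA tA' At eps0 eps1; clear; lra.
have kappaA16 : 16 * A * kappa <= 1.
  by have := mulr_gt0 A0 kappa0; move: kappaA; clear; lra.
have eps'01 : 0 < eps' <= 1 / 2 by rewrite eps'0.
have /andP[lo up] := log_matchings_sandwich (p01 n) (l_gt0 n) ln A1 kappa0 kappaA16
  beta00 betan eps0 lP sP l3P kappa_eps eps'01 eps'_le t bad_le.
have Phi_up : Phi (t + eps) <= Phi t + eta.
  have := @Phi_lipschitz R t (t + eps); rewrite lerDl (ltW eps0) => /(_ isT).
  have -> : t + eps - t = eps by ring.
  by move=> /le_trans/(_ ceps); rewrite lerBlDl.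
have Phi_lo : Phi t - eta <= Phi (t - eps).
  have := @Phi_lipschitz R (t - eps) t; rewrite gerBl (ltW eps0) => /(_ isT).
  have -> : t - (t - eps) = eps by ring.
  by move=> /le_trans/(_ ceps); rewrite lerBlDl -lerBlDr.
rewrite ler_distl; apply/andP; split.
  apply: le_trans lo; move: clt_lo Phi_lo eta_e; set S := \sum_(_ | _) _; clear; lra.
apply: le_trans up _; move: clt_up Phi_up eta_e; set S := \sum_(_ | _) _; clear; lra.
Unshelve. all: by end_near. Qed.

Theorem theorem5 (R : realType) (alpha : R) (p : nat -> R) (l : nat -> nat) :
  7 / 8 < alpha < 1 ->
  (forall n, 0 < p n < 1) ->
  n%:R * p n @[n --> \oo] --> +oo ->
  (fun n => 1 - p n : R^o) =Omega_\oo (fun=> 1 : R^o) ->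
  (forall n, (0 < l n)%N) ->
  (fun n => (l n)%:R : R^o) =Omega_\oo (fun n => n%:R * Num.sqrt (p n) : R^o) ->
  (\forall n \near \oo, (l n)%:R <= n%:R / 2 - n%:R `^ alpha) ->
  (fun n => (l n)%:R ^+ 3 : R^o) =o_\oo (fun n => n%:R ^+ 4 * p n ^+ 2 : R^o) ->
  cvg_in_distribution (T := graph)
    (P := fun n => gnp_prob n (p n))
    (fun n => log_matchings (p n) (l n)) (@normal_prob R 0 1).
Proof.
move=> alpha01 p01 np_oo q_Omega l_gt0 l_Omega l_le l3_o t _.
pose F n := \sum_(G : graph n | (log_matchings (p n) (l n) G <= t%:E)%E) gnp_pmf (p n) G.
have -> : (fun n => distribution (gnp_prob n (p n)) (log_matchings (p n) (l n))
    [set y | (y <= t%:E)%E]) = (fun n => (F n)%:E).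
  apply/funext => n; have /andP[p0 p1] := p01 n.
  apply: etrans; first by apply: gnp_probE; rewrite !ltW.
  congr EFin; apply: eq_bigl => G.
  by apply/idP/idP; rewrite inE.
suff H : (F n)%:E @[n --> \oo] --> (Phi t)%:E by rewrite -PhiE in H.
apply: cvg_EFin; first exact: nearW.
apply/cvgrPdist_le => e e0; near=> n; rewrite distrC; near: n.
exact: near_log_matchings_Phi alpha01 p01 np_oo q_Omega l_gt0 l_Omega l_le l3_o e0.
Unshelve. all: by end_near. Qed.
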